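(* Let $M\ge 1$ and $K\ge 1$ be integers, and let $I_i\colon\Omega_i\to\mathbb{R}^K$ be a noiseless junction image on a square patch $\Omega_i\subset\mathbb{R}^2$ of side length $R>0$, with vertex $\mathbf{x}^{(0)}=(x^{(0)},y^{(0)})\in\mathbb{R}^2$. That is, there exist true junction angles $\boldsymbol{\phi}_\ast=(\phi_\ast^{(1)},\dots,\phi_\ast^{(M)})\in[0,2\pi)^M$ and constant colors $c_\ast^{(1)},\dots,c_\ast^{(M)}\in\mathbb{R}^K$ such that $$I_i(\mathbf{x})=\sum_{j=1}^M u^{(j)}_{(\boldsymbol{\phi}_\ast,\mathbf{x}^{(0)})}(\mathbf{x})\,c_\ast^{(j)}\qquad\text{for (almost) all }\mathbf{x}\in\Omega_i .$$ Suppose that the vertex $\mathbf{x}^{(0)}$ is known, and consider the following algorithm: initialize $\phi^{(1)},\dots,\phi^{(M)}\leftarrow 0$; then, for $j=1,\dots,M$ in order (a single pass), set $$\phi^{(j)}\leftarrow\operatorname*{argmin}_{\phi\in[0,2\pi)}\ \ell_j(\phi),$$ where $\ell_j(\phi)=\ell(\phi^{(1)},\dots,\phi^{(j-1)},\phi,\phi^{(j+1)},\dots,\phi^{(M)},x^{(0)},y^{(0)})$ is evaluated at the current values of the other angles. Then the algorithm is guaranteed to find the globally optimal angles: its output $\boldsymbol{\phi}=(\phi^{(1)},\dots,\phi^{(M)})$ satisfies $$\ell(\boldsymbol{\phi},\mathbf{x}^{(0)})=\min_{\boldsymbol{\psi}\in[0,2\pi)^M}\ell(\boldsymbol{\ps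i},\mathbf{x}^{(0)}).$$
   Context: Generalized $M$-junctions: a junction parameter $\boldsymbol{\theta}=(\boldsymbol{\phi},\mathbf{x}^{(0)})\in\mathbb{R}^{M+2}$ consists of $M$ angles $\boldsymbol{\phi}=(\phi^{(1)},\dots,\phi^{(M)})$, taken modulo $2\pi$, and a vertex $\mathbf{x}^{(0)}\in\mathbb{R}^2$. The vertex may lie inside or outside the patch, and wedges may have size $0$. The $M$ rays emanating from $\mathbf{x}^{(0)}$ in the directions $\phi^{(1)},\dots,\phi^{(M)}$ partition the plane, and hence the patch $\Omega_i$, into $M$ angular wedges. If the angles are sorted in non-decreasing order as $\phi_{(1)}\le\dots\le\phi_{(M)}$, the $j$th wedge is the set of points whose polar angle about $\mathbf{x}^{(0)}$ lies between $\phi_{(j)}$ and $\phi_{(j+1)}$ for $j<M$, and between $\phi_{(M)}$ and $\phi_{(1)}+2\pi$ for $j=M$. The wedges between coinciding angles are empty, and if all angles coincide then one wedge is the whole patch. The function $u^{(j)}_{\boldsymbol{\theta}}\colon\Omega_i\to\{0,1\}$ is the indicator function of the $j$th wedge; values on the rays themselves, a null set, are immaterial. Negative log-likelihood (constant color model, Gaussian noise model with fixed constant $\alpha>0$): for angles $\boldsymbol{\phi}$ and vertex $\mathbf{x}^{(0)}$, with $\boldsymbol{\theta}=(\boldsymbol{\phi},\mathbf{x}^{(0)})$, $$\ell(\boldsymbol{\phi},\mathbf{x}^{(0)})=\alpha\sum_{j=1}^M\int_{\Omega_i}u^{(j)}_{\boldsymbol{\theta}}(\mathbf{x})\,\bigl\|c^{(j)}-I_i(\mathbf{x})\bigr\|^2\,d\mathbf{x},$$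 where the colors $c^{(j)}\in\mathbb{R}^K$ are the optimal ones for the given $\boldsymbol{\theta}$, namely the wedge averages $$c^{(j)}=\frac{\int_{\Omega_i}u^{(j)}_{\boldsymbol{\theta}}(\mathbf{x})I_i(\mathbf{x})\,d\mathbf{x}}{\int_{\Omega_i}u^{(j)}_{\boldsymbol{\theta}}(\mathbf{x})\,d\mathbf{x}}.$$ A wedge meeting the patch in a null set contributes $0$ to $\ell$. In the algorithm, $\operatorname{argmin}$ denotes a global minimizer of $\ell_j$ over all angles. *)

(* Defs.v *)
From HB Require Import structures.
From mathcomp Require Import all_boot all_order all_algebra.
From mathcomp Require Import all_classical all_reals all_analysis.

Set Implicit Arguments.
Unset Strict Implicit.
Unset Printing Implicit Defensive.

Import Order.TTheory GRing.Theory Num.Theory.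
Import numFieldNormedType.Exports.

Local Open Scope classical_set_scope.
Local Open Scope ring_scope.

Definition lebesgue2 (R : realType)
    : {measure set (measurableTypeR R * measurableTypeR R)%type -> \bar R} :=
  (@lebesgue_measure R \x @lebesgue_measure R)%E.

(* The sup norm `|v| of the library is not the norm of R^K used here. *)
Definition sqnorm2 (R : realType) (K : nat) (v : 'rV[R]_K) : R :=
  \sum_(k < K) v ord0 k ^+ 2.

(* The square with the given center and side length, with its sides in the
   directions tau and tau + pi/2; it is axis-parallel for tau = 0. *)
Definition square_patch (R : realType) (center : R * R) (tau side : R)
    : set (R * R) :=
  [set x | `|cos tau * (x.1 - center.1) + sin tau * (x.2 - center.2)|
             <= side / 2 /\
           `|cos tau * (x.2 - center.2) - sin tau * (x.1 - center.1)|
             <= side / 2].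

Definition angle_sector (R : realType) (x0 : R * R) (a b : R) : set (R * R) :=
  [set x | exists r t : R, [/\ 0 < r, a <= t < b &
     x = (x0.1 + r * cos t, x0.2 + r * sin t)]].

Definition sorted_angles (R : realType) (M : nat) (phi : 'I_M -> R) : seq R :=
  sort <=%R (codom phi).

(* Angles are represented in [0, 2 pi); the last wedge, j = M - 1, wraps around
   to the first angle plus 2 pi. Each wedge contains its first ray and not its
   last one, so if all the angles coincide then the last wedge is the plane
   without the vertex and the other wedges are empty. *)
Definition wedge (R : realType) (M : nat) (phi : 'I_M -> R) (x0 : R * R)
    (j : 'I_M) : set (R * R) :=
  let s := sorted_angles phi in
  angle_sector x0 (nth 0 s j)
    (if (j.+1 < M)%N then nth 0 s j.+1 else nth 0 s 0 + 2 * pi).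

Definition wedge_ind (R : realType) (M : nat) (phi : 'I_M -> R) (x0 : R * R)
    (j : 'I_M) : R * R -> R :=
  \1_(wedge phi x0 j).

(* If the wedge meets the patch in a null set then this is 0, because x / 0 = 0;
   the value is irrelevant in that case. *)
Definition wedge_color (R : realType) (M K : nat) (Omega : set (R * R))
    (I : R * R -> 'rV[R]_K) (phi : 'I_M -> R) (x0 : R * R) (j : 'I_M)
    : 'rV[R]_K :=
  \row_(k < K)
    (\int[lebesgue2 R]_(x in Omega) (wedge_ind phi x0 j x * I x ord0 k) /
     \int[lebesgue2 R]_(x in Omega) wedge_ind phi x0 j x).

Definition junction_nll (R : realType) (M K : nat) (alpha : R)
    (Omega : set (R * R)) (I : R * R -> 'rV[R]_K) (phi : 'I_M -> R)
    (x0 : R * R) : R :=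
  alpha * \sum_(j < M)
    \int[lebesgue2 R]_(x in Omega)
      (wedge_ind phi x0 j x * sqnorm2 (wedge_color Omega I phi x0 j - I x)).

(* I is only assumed to agree almost everywhere on Omega with the junction
   image. The product of the Borel-Lebesgue measures is not complete, so I need
   not be measurable; the library integral, a difference of suprema over simple
   functions, is still insensitive to null sets for such I. *)
Definition noiseless_junction_image (R : realType) (M K : nat)
    (Omega : set (R * R)) (I : R * R -> 'rV[R]_K) (x0 : R * R)
    (phi : 'I_M -> R) (c : 'I_M -> 'rV[R]_K) : Prop :=
  {ae lebesgue2 R, forall x, Omega x ->
    I x = \sum_(j < M) wedge_ind phi x0 j x *: c j}.

Definition argmin_on (R : realType) (T : Type) (D : set T) (f : T -> R)
    : set T :=
  [set x | D x /\ forall y, D y -> f x <= f y].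

Definition angle_range (R : realType) : set R := [set a | 0 <= a < 2 * pi].
Arguments angle_range : clear implicits.

Definition angle_box (R : realType) (M : nat) : set ('I_M -> R) :=
  [set phi | forall j, angle_range R (phi j)].
Arguments angle_box : clear implicits.

Definition set_angle (R : realType) (M : nat) (phi : 'I_M -> R) (j : 'I_M)
    (a : R) : 'I_M -> R :=
  fun i => if i == j then a else phi i.

(* t n is the vector of angles after n updates of the single pass. The choice
   among several minimizers is left open. *)
Definition coordinate_pass (R : realType) (M : nat) (l : ('I_M -> R) -> R)
    (t : nat -> 'I_M -> R) : Prop :=
  t 0%N = (fun=> 0) /\
  forall j : 'I_M, exists2 a : R,
    argmin_on (angle_range R) (fun b => l (set_angle (t j) j b)) a &
    t j.+1 = set_angle (t j) j a.

(* Main.v *)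
(** On the circle of directions around the vertex, a junction image is a step
function, and the loss of a wedge is the variance of its colors. A new ray
[b] in an arc decreases the loss by a gain which, as a function of the mass
[y] cut off by [b], is [m |D y|^2 / (y (m - y))] for an arc of mass [m], where
[D] is affine between consecutive true rays. Comparing with a constant [g]
thus amounts to a concave quadratic inequality in [y], so that a positive
maximal gain is attained only at true rays, up to arcs that meet the patch in a
null set; and if no true ray in an arc has a positive gain, then the color is
constant on the arc. During the pass the ray at angle [0] is kept until the
last update. Hence every update either starts from loss zero or hits a new true
ray, and the last update can complete the set of true rays; so the pass ends
with loss zero. *)
Require Import Defs.
From mathcomp Require Import all_boot all_order all_algebra.
From mathcomp Require Import all_classical all_reals all_analysis.
From mathcomp Require Import measurable_realfun.
From mathcomp Require Import ring lra zify.

Set Implicit Arguments.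
Unset Strict Implicit.
Unset Printing Implicit Defensive.

Import Order.TTheory GRing.Theory Num.Theory.
Import numFieldNormedType.Exports.

Local Open Scope classical_set_scope.
Local Open Scope ring_scope.

(** * Splitting an arc *)

(* F, S k and Q stand for the integrals of 1, of the k-th color component and of
   its squared norm over the directions in [0, t). They are continued to
   [0, 2 P], for a period P, so that no arc wraps around; ts lists the true rays. *)
Section CircularSegmentation.
Variables (R : realFieldType) (K : nat) (P : R).
Variables (F Q : R -> R) (S : 'I_K -> R -> R) (ts : seq R).

(** The vertex may lie outside the patch and true angles may coincide, so [F] is monotone but in
    general not strictly so, and minimizers are not unique. A chosen angle can therefore be matched
    with a true ray only up to a null sector, and only if its gain is positive: at gain zero any
    angle may be chosen. Progress is measured by the number of true rays already hit in this sense.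
    Since all angles start at 0, taking out a ray at 0 before the last update leaves another copy of
    it behind; this does not change the loss, so the update is a pure insertion. After [M - 1]
    insertions that start from a positive loss at most one true ray is not hit. The last update
    gives up the ray at 0, and it is enough to compare its result with the choice of the missing
    ray. *)

Definition unrolled_breaks := ts ++ [seq t + P | t <- ts].
Local Notation B := unrolled_breaks.

(** The color is a constant vector [c] between breaks: the slope of [S k] with respect to [F] is
    [c k], and that of [Q] is the squared norm of the same [c]. *)
Definition affine_between_breaks := forall u v : R,
  0 <= u -> u <= v -> v <= P + P ->
  (forall t, t \in B -> u < t -> v <= t) ->
  exists c : 'I_K -> R, forall x : R, u <= x -> x <= v ->
    (forall k, S k x - S k u = c k * (F x - F u)) /\
    Q x - Q u = (\sum_k c k ^+ 2) * (F x - F u).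

(** Mass times variance, in expanded form. On an arc of mass zero the quotient is 0, as division by
    0 gives 0. *)
Definition arc_loss u v :=
  Q v - Q u - \sum_k (S k v - S k u) ^+ 2 / (F v - F u).

Definition split_gain u b v := \sum_k ((S k b - S k u) ^+ 2 / (F b - F u)
  + (S k v - S k b) ^+ 2 / (F v - F b) - (S k v - S k u) ^+ 2 / (F v - F u)).

Lemma arc_loss_split u b v :
  arc_loss u b + arc_loss b v = arc_loss u v - split_gain u b v.
Proof.
rewrite /split_gain sumrB big_split /= /arc_loss; lra.
Qed.

(** The [D] of the overview: the integral over [[u, x)] of the deviation of the color from its mean
    over [[u, v)]. *)
Definition centered u v k x :=
  (S k x - S k u) - (S k v - S k u) / (F v - F u) * (F x - F u).

(** The bracket starts as [[u, v]], and each break strictly inside it replaces one of its ends,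
    depending on its side of [b]. *)
Lemma no_break_bracket (l : seq R) u b v : u <= b -> b <= v ->
  exists p q, [/\ p \in u :: l, q \in v :: l, u <= p <= b, b <= q <= v &
    forall t, t \in l -> p < t -> q <= t].
Proof.
move=> ub bv; elim: l => [|t l [p [q [pl ql /andP[up pb] /andP[bq qv] pq]]]].
  by exists u, v; rewrite !inE !eqxx ub bv !lexx.
have inl w z : w \in z :: l -> w \in [:: z, t & l].
  by rewrite !inE => /orP[->//|->]; rewrite !orbT.
have [[pt tq]|ptq] : (p < t /\ t < q) \/ (p < t -> q <= t).
- by case: (ltP p t); case: (ltP t q); [left|right|right|right].
- have [bt|tb] := leP b t.
  + exists p, t; split; rewrite ?inE ?eqxx ?orbT ?up ?pb ?bt//=.
    * by have := inl _ _ pl; rewrite !inE.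
    * by rewrite (le_trans (ltW tq)).
    * move=> w; rewrite inE => /predU1P[->//|wl pw].
      by rewrite (le_trans (ltW tq)) ?pq.
  + exists t, q; split; rewrite ?inE ?eqxx ?orbT ?bq ?qv ?(ltW tb) ?andbT//=.
    * by have := inl _ _ ql; rewrite !inE.
    * by rewrite (le_trans up (ltW pt)).
    * move=> w; rewrite inE => /predU1P[->|wl tw]; first by rewrite ltxx.
      by rewrite pq// (lt_trans pt).
- exists p, q; rewrite up pb bq qv; split => //; try exact: inl.
  by move=> w; rewrite inE => /predU1P[->//|]; exact: pq.
Qed.

(** Breaks are removed one by one: an interval that contains the removed break in its interior is
    cut there. *)
Lemma eq_across_breaks (l : seq R) (g : R -> R) u v : u <= v ->
  (forall x y, u <= x -> x <= y -> y <= v ->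
    (forall t, t \in l -> x < t -> y <= t) -> g x = g y) ->
  g u = g v.
Proof.
move=> uv; elim: l => [|t l IHl] gl; first exact: gl.
apply: IHl => x y ux xy yv xyl.
have [[xt ty]|xty] : (x < t /\ t < y) \/ (x < t -> y <= t).
- by case: (ltP x t); case: (ltP t y); [left|right|right|right].
- transitivity (g t).
  + apply: gl => //; [exact: ltW|exact: le_trans (ltW ty) yv|].
    move=> w; rewrite inE => /predU1P[->//|wl xw].
    by rewrite (le_trans (ltW ty)) ?xyl.
  + apply: gl => //; [exact: le_trans ux (ltW xt)|exact: ltW|].
    move=> w; rewrite inE => /predU1P[->|wl tw]; first by rewrite ltxx.
    by rewrite xyl// (lt_trans xt).
- by apply: gl => // w; rewrite inE => /predU1P[->//|]; exact: xyl.
Qed.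

Hypothesis F_homo : forall u v : R, 0 <= u -> u <= v -> v <= P + P -> F u <= F v.
Hypothesis affP : affine_between_breaks.

(** All increments are multiples of the increment of [F] on each piece. This makes the convention
    for division by zero harmless. *)
Lemma null_arc u v : 0 <= u -> u <= v -> v <= P + P -> F u = F v ->
  Q u = Q v /\ forall k, S k u = S k v.
Proof.
move=> u0 uv v2 Fuv.
have Fc x y : u <= x -> x <= y -> y <= v -> F y - F x = 0.
  move=> ux xy yv; have xv := le_trans xy yv.
  have := F_homo u0 ux (le_trans xv v2).
  have := F_homo (le_trans u0 ux) xy (le_trans yv v2).
  have := F_homo (le_trans (le_trans u0 ux) xy) yv v2.
  by rewrite Fuv; lra.
split=> [|k]; apply: (@eq_across_breaks B) => // x y ux xy yv xyB;
  have [c /(_ y xy (lexx _))[Sc Qc]] :=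
    affP (le_trans u0 ux) xy (le_trans yv v2) xyB.
- by move: Qc; rewrite Fc// mulr0 => /eqP; rewrite subr_eq0 => /eqP.
- by move: (Sc k); rewrite Fc// mulr0 => /eqP; rewrite subr_eq0 => /eqP.
Qed.

Section Arc.
Variables u v : R.
Hypotheses (u0 : 0 <= u) (uv : u <= v) (v2 : v <= P + P).

Lemma null_arc_within x y : u <= x -> x <= y -> y <= v -> F x = F y ->
  forall k, S k x = S k y.
Proof.
move=> ux xy yv Fxy; have [] := @null_arc x y => //.
- exact: le_trans ux.
- exact: le_trans v2.
Qed.

Lemma F_within x y : u <= x -> x <= y -> y <= v -> F x <= F y.
Proof.
move=> ux xy yv; apply: F_homo => //; [exact: le_trans ux|exact: le_trans v2].
Qed.

Lemma centered_left k b : u <= b -> b <= v -> F b = F u -> centered u v k b = 0.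
Proof.
move=> ub bv Fb; rewrite /centered (null_arc_within (lexx u) ub bv (esym Fb)).
by rewrite Fb !subrr mulr0 subrr.
Qed.

Lemma centered_right k b : u <= b -> b <= v -> F b = F v -> centered u v k b = 0.
Proof.
move=> ub bv Fb; rewrite /centered (null_arc_within ub bv (lexx v) Fb) Fb.
have [Fuv|Fuv] := eqVneq (F v - F u) 0; last by rewrite divfK// subrr.
rewrite Fuv !mulr0 subr0 (null_arc_within (lexx u) uv (lexx v)) ?subrr//.
by move/eqP: Fuv; rewrite subr_eq0 => /eqP.
Qed.

(** The gain formula with denominators cleared. It also covers a ray that cuts off mass zero, since
    [centered] vanishes there. *)
Lemma split_gainE b : u <= b -> b <= v ->
  split_gain u b v * ((F b - F u) * (F v - F b))
  = (F v - F u) * \sum_k centered u v k b ^+ 2.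
Proof.
move=> ub bv; rewrite mulr_suml mulr_sumr; apply: eq_bigr => k _.
have [Fub|Fub] := eqVneq (F b) (F u).
  by rewrite (centered_left _ ub bv)// Fub expr0n /=; lra.
have [Fbv|Fbv] := eqVneq (F b) (F v).
  by rewrite (centered_right _ ub bv)// Fbv expr0n /=; lra.
have := F_within (lexx u) ub bv; have := F_within ub bv (lexx v).
move=> bv' ub'; rewrite /centered; field.
by rewrite !subr_eq0; apply/and3P; split; apply/eqP; lra.
Qed.

Lemma split_gain_null b : u <= b -> b <= v -> F b = F u \/ F b = F v ->
  split_gain u b v = 0.
Proof.
move=> ub bv [Fb|Fb]; rewrite /split_gain big1// => k _.
- rewrite (null_arc_within (lexx u) ub bv (esym Fb)) Fb.
  by rewrite !subrr invr0 mulr0 add0r subrr.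
- rewrite (null_arc_within ub bv (lexx v) Fb) Fb.
  by rewrite !subrr invr0 mulr0 addr0 subrr.
Qed.

Lemma split_gain_ge0 b : u <= b -> b <= v -> 0 <= split_gain u b v.
Proof.
move=> ub bv.
have [Fub|Fub] := eqVneq (F b) (F u); first by rewrite split_gain_null//; left.
have [Fbv|Fbv] := eqVneq (F b) (F v); first by rewrite split_gain_null//; right.
have := F_within (lexx u) ub bv; have := F_within ub bv (lexx v).
move=> bv' ub'.
have m0 : 0 < (F b - F u) * (F v - F b).
  by rewrite mulr_gt0// subr_gt0 lt_neqAle ?bv' ?ub' andbT// eq_sym.
rewrite -(pmulr_lge0 _ m0) split_gainE// mulr_ge0 ?subr_ge0//.
  by rewrite (le_trans ub').
by rewrite sumr_ge0// => k _; rewrite sqr_ge0.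
Qed.

(** This justifies treating the gain as a function of the mass cut off. *)
Lemma split_gain_congr b b' : u <= b -> b <= v -> u <= b' -> b' <= v ->
  F b = F b' -> split_gain u b v = split_gain u b' v.
Proof.
move=> ub bv ub' bv' Fb; apply: eq_bigr => k _; rewrite Fb.
suff -> : S k b = S k b' by [].
by case/orP: (le_total b b') => bb';
  [|apply/esym]; apply: null_arc_within.
Qed.

(* With [y = F x - F u], the inequality [split_gain u x v <= g] reads
   [0 <= g y (m - y) - m |D|^2]; between two breakpoints [D] is affine in [y],
   so that the right-hand side is a concave quadratic function of [y]. *)
Lemma split_gain_max g b : 0 <= g -> u <= b -> b <= v ->
  (forall t, t \in B -> u < t < v -> split_gain u t v <= g) ->
  split_gain u b v <= g /\
  (0 < g -> split_gain u b v < g \/ exists2 t, t \in B & u < t < v /\ F t = F b).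
Proof.
move=> g0 ub bv gB.
have [p [q [pB qB /andP[up pb] /andP[bq qv] pq]]] := no_break_bracket B ub bv.
have inB w z : w \in z :: B -> w != z -> w \in B.
  by rewrite inE => /predU1P[->|//]; rewrite eqxx.
(* An end of the bracket is either a break inside the arc, where the hypothesis bounds the gain, or
   an end of the arc, where the gain is 0. *)
have gainP w z : z \in [:: u; v] -> w \in z :: B -> u <= w -> w <= v ->
    split_gain u w v <= g /\ (split_gain u w v != 0 -> w \in B /\ u < w < v).
  move=> zuv wB uw wv.
  have [wu|wu] := eqVneq w u.
    by rewrite wu split_gain_null//; [rewrite eqxx | left].
  have [wv'|wv'] := eqVneq w v.
    by rewrite wv' split_gain_null//; [rewrite eqxx | right].
  have uwv : u < w < v by rewrite !lt_neqAle uw wv wv' eq_sym wu.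
  have wB' : w \in B.
    by apply: inB wB _; move: zuv; rewrite !inE => /orP[]/eqP->.
  by split=> //; exact: gB.
have := gainP p u; rewrite !inE eqxx; case/(_ isT pB up); first lra.
move=> gp gp0.
have := gainP q v; rewrite !inE eqxx orbT; case/(_ isT qB _ qv); first lra.
move=> gq gq0.
(* If [b] is separated from an end of the bracket by mass zero, it has the gain of that end. *)
have edge w : u <= w -> w <= v -> F b = F w -> split_gain u w v <= g ->
    (split_gain u w v != 0 -> w \in B /\ u < w < v) ->
    split_gain u b v <= g /\ (0 < g -> split_gain u b v < g \/
      exists2 t, t \in B & u < t < v /\ F t = F b).
  move=> uw wv Fbw gw gw0; rewrite (split_gain_congr ub bv uw wv Fbw).
  split=> // g'; have [w0|/gw0[wB uwv]] := eqVneq (split_gain u w v) 0.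
    by left; rewrite w0.
  by right; exists w.
have [Fpb|Fpb] := eqVneq (F b) (F p).
  by apply: (edge p) => //; lra.
have [Fqb|Fqb] := eqVneq (F b) (F q).
  by apply: (edge q) => //; lra.
have Fup : F u <= F p by apply: F_within; lra.
have Fpb' : F p < F b by rewrite lt_neqAle eq_sym Fpb F_within//; lra.
have Fbq' : F b < F q by rewrite lt_neqAle Fqb F_within//; lra.
have Fqv : F q <= F v by apply: F_within; lra.
have m0 : 0 < (F b - F u) * (F v - F b).
  by rewrite mulr_gt0// subr_gt0; lra.
pose Z x := g * ((F x - F u) * (F v - F x))
  - (F v - F u) * \sum_k centered u v k x ^+ 2.
have ZE x : u <= x -> x <= v ->
    Z x = (g - split_gain u x v) * ((F x - F u) * (F v - F x)).
  by move=> ux xv; rewrite /Z -split_gainE//; ring.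
have Zge0 x : u <= x -> x <= v -> split_gain u x v <= g -> 0 <= Z x.
  move=> ux xv gx; rewrite ZE// mulr_ge0 ?subr_ge0//.
  by rewrite mulr_ge0// subr_ge0; apply: F_within.
have Zp : 0 <= Z p by apply: Zge0 => //; lra.
have Zq : 0 <= Z q by apply: Zge0 => //; lra.
have [c cP] : exists c : 'I_K -> R, forall x, p <= x -> x <= q ->
    (forall k, S k x - S k p = c k * (F x - F p)) /\
    Q x - Q p = (\sum_k c k ^+ 2) * (F x - F p).
  by apply: affP => //; have := u0; have := v2; lra.
pose e k := c k - (S k v - S k u) / (F v - F u).
have De k x : p <= x -> x <= q ->
    centered u v k x = centered u v k p + e k * (F x - F p).
  move=> px xq; have [/(_ k) Sx _] := cP x px xq.
  have {}Sx : S k x = S k p + c k * (F x - F p) by rewrite -Sx addrC subrK.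
  by rewrite /centered /e Sx; ring.
(* A quadratic with leading coefficient [- A] exceeds its chord by [A] times the product of the
   distances to the two ends; here [A] is [g] plus the mass of the arc times the squared norm of
   [e]. *)
have ZbE : Z b * (F q - F p) = (F q - F b) * Z p + (F b - F p) * Z q
    + (g + (F v - F u) * \sum_k e k ^+ 2)
      * ((F b - F p) * (F q - F b) * (F q - F p)).
  rewrite /Z.
  under eq_bigr => k _ do rewrite (De k b) ?pb ?bq//.
  rewrite [X in _ = _ + _ * (_ - _ * X) + _](eq_bigr (fun k =>
    (centered u v k p + e k * (F q - F p)) ^+ 2)); last first.
    by move=> k _; rewrite (De k q)// (le_trans pb).
  have expand y : \sum_k (centered u v k p + e k * y) ^+ 2 =
     \sum_k centered u v k p ^+ 2
     + (\sum_k centered u v k p * e k) * (y *+ 2) + (\sum_k e k ^+ 2) * y ^+ 2.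
    rewrite !mulr_suml -!big_split/=; apply: eq_bigr => k _; ring.
  by rewrite !expand; ring.
have Zb : g * ((F b - F p) * (F q - F b)) <= Z b.
  have Fpq : 0 < F q - F p by lra.
  rewrite -(ler_pM2r Fpq) ZbE.
  have e0 : 0 <= (F v - F u) * \sum_k e k ^+ 2.
    apply: mulr_ge0; first lra.
    by apply: sumr_ge0 => k _; rewrite sqr_ge0.
  have w0 : 0 <= (F b - F p) * (F q - F b) * (F q - F p).
    by rewrite !mulr_ge0//; lra.
  have a0 : 0 <= (F q - F b) * Z p by rewrite mulr_ge0//; lra.
  have b0 : 0 <= (F b - F p) * Z q by rewrite mulr_ge0//; lra.
  rewrite mulrDl -mulrA; have := mulr_ge0 e0 w0; rewrite -!mulrA; lra.
rewrite ZE// in Zb.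
have w0 : 0 < (F b - F p) * (F q - F b) by rewrite mulr_gt0//; lra.
split=> [|g'].
  by rewrite -subr_ge0 -(pmulr_lge0 _ m0) (le_trans _ Zb)// mulr_ge0// ltW.
by left; rewrite -subr_gt0 -(pmulr_lgt0 _ m0) (lt_le_trans _ Zb)// mulr_gt0.
Qed.

(** Apply [split_gain_max] with the gain of [b] itself as [g]: if no break does better, the strict
    alternative is absurd and [b] has the same mass coordinate as a break. *)
Lemma split_gain_improve b : u <= b -> b <= v -> 0 < split_gain u b v ->
  exists2 t, t \in B & u < t < v /\
    (split_gain u b v < split_gain u t v \/
     split_gain u b v = split_gain u t v /\ F t = F b).
Proof.
move=> ub bv g0.
have [/hasP[t tB /and3P[ut tv gt]]|/hasPn hB] := boolP (has (fun t =>
    [&& u < t, t < v & split_gain u b v < split_gain u t v]) B).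
  by exists t => //; split; [rewrite ut|left].
have [] := @split_gain_max (split_gain u b v) b (ltW g0) ub bv.
  by move=> t /hB; case/nandP => [/negP ut|/nandP[/negP tv|]]; rewrite ?leNgt//;
    case/andP.
move=> _ /(_ g0)[|[t tB [utv Ft]]]; first by rewrite ltxx.
exists t => //; split=> //; right; split=> //.
by apply: split_gain_congr => //; case/andP: utv => *; exact: ltW.
Qed.

(** The gain vanishes on the whole arc, hence so does [centered]. So the color of each piece of
    positive mass is the mean color of the arc. *)
Lemma arc_loss_eq0 : (forall t, t \in B -> u < t < v -> split_gain u t v <= 0) ->
  arc_loss u v = 0.
Proof.
move=> gB.
have gain0 x : u <= x -> x <= v -> split_gain u x v = 0.
  move=> ux xv; apply/eqP; rewrite eq_le split_gain_ge0// andbT.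
  by have [] := @split_gain_max 0 x (lexx _) ux xv gB.
have [Fuv|Fuv] := eqVneq (F u) (F v).
  have [Quv _] := null_arc u0 uv v2 Fuv; rewrite /arc_loss Quv Fuv !subrr.
  by rewrite big1 ?subrr// => k _; rewrite invr0 mulr0.
have m0 : F v - F u != 0 by rewrite subr_eq0 eq_sym.
pose mean k := (S k v - S k u) / (F v - F u).
have Sx x k : u <= x -> x <= v -> S k x - S k u = mean k * (F x - F u).
  move=> ux xv; have /esym/eqP := split_gainE ux xv.
  rewrite gain0// mul0r mulf_eq0 (negPf m0) /= psumr_eq0; last first.
    by move=> i _; rewrite sqr_ge0.
  move=> /allP/(_ k); rewrite mem_index_enum => /(_ isT) /=.
  by rewrite sqrf_eq0 /centered subr_eq0 => /eqP.
(* On a piece of positive mass the slope [c] equals [mean]; on a null piece both sides are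
   constant. *)
have QF : Q u - (\sum_k mean k ^+ 2) * F u = Q v - (\sum_k mean k ^+ 2) * F v.
  apply: (@eq_across_breaks B (fun x => Q x - (\sum_k mean k ^+ 2) * F x)) => //.
  move=> x y ux xy yv xyB.
  have [c /(_ y xy (lexx _))[Sc Qc]] :=
    affP (le_trans u0 ux) xy (le_trans yv v2) xyB.
  suff : Q y - Q x = (\sum_k mean k ^+ 2) * (F y - F x) by lra.
  rewrite Qc !mulr_suml; apply: eq_bigr => k _.
  have [->|Fxy] := eqVneq (F y - F x) 0; first by rewrite !mulr0.
  have : c k * (F y - F x) = mean k * (F y - F x).
    have := Sx x k ux (le_trans xy yv); have := Sx y k (le_trans ux xy) yv.
    by rewrite -(Sc k); lra.
  by move/(mulIf Fxy) => ->.
rewrite /arc_loss (eq_bigr (fun k => mean k ^+ 2 * (F v - F u))); last first.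
  by move=> k _; rewrite /mean; field.
by rewrite -mulr_suml; lra.
Qed.

End Arc.
End CircularSegmentation.

(** * Cyclic sequences of rays *)

Lemma sort_cons_eq (R : realDomainType) (s s1 s2 : seq R) (b : R) :
  sorted <=%R (s1 ++ b :: s2) -> s = s1 ++ s2 ->
  sort <=%R (b :: s) = s1 ++ b :: s2.
Proof.
move=> sb ->; apply: (sorted_eq le_trans le_anti) => //.
  by apply: sort_sorted; exact: le_total.
by rewrite perm_sort -cat1s perm_catCA.
Qed.

Lemma sorted_insert (R : realDomainType) (s1 s2 : seq R) (u b v : R) :
  sorted <=%R (s1 ++ u :: v :: s2) -> u <= b -> b <= v ->
  sorted <=%R (s1 ++ u :: b :: v :: s2).
Proof.
move=> + ub bv; case: s1 => [|x s1] /=; first by rewrite ub bv => /andP[].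
by rewrite !cat_path /= ub bv => /and4P[-> -> _ ->].
Qed.

Section CyclicLoss.
Variables (R : realFieldType) (K : nat) (P : R).
Variables (F Q : R -> R) (S : 'I_K -> R -> R) (ts : seq R).
Hypothesis P0 : 0 < P.
Hypothesis F_homo : forall u v : R, 0 <= u -> u <= v -> v <= P + P -> F u <= F v.
Hypothesis affP : affine_between_breaks P F Q S ts.
Hypothesis FP : forall x : R, 0 <= x -> x <= P -> F (x + P) = F x + F P.
Hypothesis QP : forall x : R, 0 <= x -> x <= P -> Q (x + P) = Q x + Q P.
Hypothesis SP : forall k (x : R), 0 <= x -> x <= P -> S k (x + P) = S k x + S k P.
Hypothesis tsP : forall t, t \in ts -> 0 <= t < P.

Local Notation lam := (arc_loss F Q S).
Local Notation gam := (split_gain F S).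

Fixpoint path_loss x s :=
  if s is y :: s' then lam x y + path_loss y s' else 0.

Definition chain_loss s := if s is x :: s' then path_loss x s' else 0.

(** The added entry is the end of the last wedge, so that a list of n rays yields n arcs. *)
Definition unrolled s := rcons s (head 0 s + P).

Definition cyclic_loss s := chain_loss (unrolled s).

Definition insertion_gain s b := cyclic_loss s - cyclic_loss (sort <=%R (b :: s)).

Lemma path_loss_cat x s1 u s2 :
  path_loss x (s1 ++ u :: s2) = path_loss x (rcons s1 u) + path_loss u s2.
Proof.
elim: s1 x => [|y s1 IHs] x /=; first by rewrite addr0.
by rewrite IHs addrA.
Qed.

Lemma chain_loss_cat s1 u s2 :
  chain_loss (s1 ++ u :: s2) = chain_loss (rcons s1 u) + chain_loss (u :: s2).
Proof. by case: s1 => [|x s1] /=; [rewrite add0r | rewrite path_loss_cat]. Qed.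

Lemma chain_loss_rcons s u v :
  chain_loss (rcons (rcons s u) v) = chain_loss (rcons s u) + lam u v.
Proof. by rewrite -cats1 cat_rcons chain_loss_cat /= addr0. Qed.

Lemma chain_loss_insert s1 u b v s2 :
  chain_loss (s1 ++ u :: b :: v :: s2) =
  chain_loss (s1 ++ u :: v :: s2) - gam u b v.
Proof.
by rewrite !chain_loss_cat /=; have := arc_loss_split F Q S u b v; lra.
Qed.

Lemma arc_loss_shift x y : 0 <= x -> x <= P -> 0 <= y -> y <= P ->
  lam (x + P) (y + P) = lam x y.
Proof.
move=> x0 xP y0 yP; rewrite /arc_loss !FP// !QP//.
have -> : forall a b c : R, a + c - (b + c) = a - b by move=> *; ring.
congr (_ - _); apply: eq_bigr => k _; rewrite !SP//.
by congr (_ ^+ 2 / _); ring.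
Qed.

Definition cyclic_gap s u v := exists s1 s2, unrolled s = s1 ++ u :: v :: s2.

Definition angle_list s := (forall t, t \in s -> 0 <= t < P) /\ sorted <=%R s.

Lemma unrolled_sorted s : angle_list s -> sorted <=%R (unrolled s).
Proof.
case: s => [//|x s] [sP /= ss]; rewrite rcons_path ss /=.
have /andP[x0 _] := sP _ (mem_head x s).
by have /andP[_ lP] := sP _ (mem_last x s); rewrite (le_trans (ltW lP))// lerDr.
Qed.

Lemma gapP s u v : angle_list s -> cyclic_gap s u v ->
  [/\ u \in s, u <= v, v <= head 0 s + P &
    forall w, w \in s -> w <= u \/ v <= w].
Proof.
move=> sA [s1 [s2 E]]; have ss := unrolled_sorted sA.
have srt := ss; move: srt; rewrite (sorted_pairwise le_trans) E.
rewrite pairwise_cat /= => /and4P[/allrelP a1 _ /andP[uv /allP us2] /andP[/allP vs2 _]].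
have us : u \in s.
  suff: u \in belast (head 0 (unrolled s)) (behead (unrolled s)).
    by rewrite /unrolled; case: {+}s => [|x s'] //=; rewrite belast_rcons.
  rewrite E; case: (s1) => [|x s1'] /=; first by rewrite mem_head.
  rewrite belast_cat mem_cat; apply/orP; right => /=.
  by rewrite inE mem_head orbT.
have vE : v <= head 0 s + P.
  have : head 0 s + P = last v s2.
    by have := congr1 (last 0) E; rewrite /unrolled last_rcons last_cat /=.
  move=> ->; have := mem_last v s2; rewrite inE => /predU1P[->//|]; exact: vs2.
split => // w ws; have : w \in unrolled s by rewrite mem_rcons inE ws orbT.
rewrite E mem_cat !inE => /orP[ws1|/or3P[/eqP->|/eqP->|/vs2]];
  [|by left|by right|by right].
by left; apply: a1; rewrite // !inE eqxx.
Qed.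

Lemma gap_bounds s u v : angle_list s -> cyclic_gap s u v ->
  [/\ 0 <= u, u < P, u <= v, v <= P + P & forall w, w \in s -> v <= w + P].
Proof.
move=> sA sg; have [us uv vh _] := gapP sA sg.
have /andP[u0 uP] := sA.1 _ us.
have h : head 0 s \in s by case: (s) us => // x s' _; rewrite mem_head.
have /andP[h0 hP] := sA.1 _ h.
split => //; first by rewrite (le_trans vh)// lerD2r ltW.
move=> w ws; rewrite (le_trans vh)// lerD2r.
have [_] := sA; move: ws {h h0 hP vh sg us sA}; case: s => [//|x s] /=.
rewrite inE => /predU1P[->//|ws]; rewrite (path_sortedE le_trans).
by case/andP => /allP/(_ _ ws).
Qed.

(** A direction before the first ray belongs to the last arc, which meets it only one period
    later. *)
Definition angle_lift b b' := b' = b \/ b' = b + P.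

Lemma lift_gap s b : angle_list s -> s != [::] -> 0 <= b < P ->
  exists u v b', [/\ cyclic_gap s u v, angle_lift b b', u <= b' & b' <= v].
Proof.
move=> sA; have := unrolled_sorted sA.
case: s sA => [//|x s] sA + _ /andP[b0 bP].
have /andP[x0 xP] := sA.1 _ (mem_head x s).
have [bx _|xb] := leP b x.
  exists (last x s), (x + P), (b + P); split.
  - by exists (belast x s), [::]; rewrite -cat_rcons -lastI cats1.
  - by right.
  - have /andP[_ lP] := sA.1 _ (mem_last x s).
    by rewrite (le_trans (ltW lP))// lerDr.
  - by rewrite lerD2r.
rewrite /unrolled /= => ps.
suff [u [v [s1 [s2 [E ub bv]]]]] : exists u v s1 s2,
    [/\ x :: rcons s (x + P) = s1 ++ u :: v :: s2, u <= b & b <= v].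
  by exists u, v, b; split; [exists s1, s2 | left | |].
have : b <= x + P by rewrite (le_trans (ltW bP))// lerDr.
move: (x + P) {sA ps} (ltW xb) => y; clear -R.
elim: s x => [|z s IHs] x xb yb; first by exists x, y, [::], [::].
have [zb|bz] := leP z b.
  have [u [v [s1 [s2 [E ub bv]]]]] := IHs z zb yb.
  by exists u, v, (x :: s1), s2; rewrite /= E.
by exists x, z, [::], (rcons s y); split => //; exact: ltW.
Qed.

(** Only the arc that receives the ray changes. The delicate case is the lift [b + P]: then [b]
    becomes the head of the list and moves the point where the circle is cut open. *)
Lemma insertion_gainE s u v b b' : angle_list s -> cyclic_gap s u v -> 0 <= b < P ->
  angle_lift b b' -> u <= b' -> b' <= v -> insertion_gain s b = gam u b' v.
Proof.
move=> sA sg /andP[b0 bP] bl ub bv.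
have [us uv vh _] := gapP sA sg; have [u0 uP _ v2 _] := gap_bounds sA sg.
have [s1 [s2 E]] := sg; rewrite /insertion_gain /cyclic_loss E.
case: bl => [bb|bb]; subst b'.
- case/lastP: s2 E => [|s2 w] E.
    have /rcons_inj[sE vE] : rcons s (head 0 s + P) = rcons (rcons s1 u) v.
      by rewrite -[RHS]cats1 cat_rcons -E.
    have sb : sort <=%R (b :: s) = rcons s b.
      rewrite (@sort_cons_eq _ s s [::])// ?cats1 ?cats0//.
      have [_] := sA; rewrite sE; case: (s1) => [|x s1'] /=; first by rewrite ub.
      by rewrite !rcons_path last_rcons ub andbT.
    have -> : unrolled (sort <=%R (b :: s)) = s1 ++ u :: b :: [:: v].
      rewrite sb /unrolled -vE -cat_rcons sE -!cats1 /= -!catA /=.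
      by case: (s1).
    by rewrite chain_loss_insert -cat_rcons cats1; ring.
  have /rcons_inj[sE wE] : rcons s (head 0 s + P) = rcons (s1 ++ u :: v :: s2) w.
      by rewrite rcons_cat /= -E.
  have sb : sort <=%R (b :: s) = s1 ++ u :: b :: v :: s2.
    rewrite -cat_rcons (@sort_cons_eq _ s (rcons s1 u) (v :: s2))//.
      by rewrite cat_rcons; apply: sorted_insert => //; rewrite -sE; case: sA.
    by rewrite cat_rcons.
  have -> : unrolled (sort <=%R (b :: s)) = s1 ++ u :: b :: v :: rcons s2 w.
    by rewrite sb /unrolled -wE sE rcons_cat /=; case: (s1).
  by rewrite chain_loss_insert; ring.
- case/lastP: s2 E => [|s2 w] E; last first.
    have /rcons_inj[sE wE] : rcons s (head 0 s + P) = rcons (s1 ++ u :: v :: s2) w.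
      by rewrite rcons_cat /= -E.
    (* An arc other than the last one ends below [P] and cannot contain [b + P]. *)
    have /(sA.1) /andP[_] : v \in s by rewrite sE mem_cat !inE eqxx !orbT.
    by move/(le_lt_trans bv); rewrite ltNge lerDr b0.
  have /rcons_inj[sE vE] : rcons s (head 0 s + P) = rcons (rcons s1 u) v.
      by rewrite -[RHS]cats1 cat_rcons -E.
  have bh : b <= head 0 s by move: bv; rewrite -vE lerD2r.
  have hs : head 0 s \in s by move: us; case: (s) => // x s' _; rewrite mem_head.
  have /andP[h0 hP] := sA.1 _ hs.
  have -> : sort <=%R (b :: s) = b :: s.
    rewrite (@sort_cons_eq _ s [::] s)//= path_min_sorted ?sA.2//.
    apply/allP => w ws; rewrite (le_trans bh)//.
    have [_] := sA; move: ws; case: (s) => [//|x s'] /=.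
    rewrite inE => /predU1P[->//|ws]; rewrite (path_sortedE le_trans).
    by case/andP => /allP/(_ _ ws).
  rewrite -cat_rcons cats1 chain_loss_rcons /unrolled rcons_cons [head _ _]/=.
  have -> : chain_loss (b :: rcons s (b + P)) =
      lam b (head 0 s) + chain_loss (rcons s (b + P)).
    by move: us; case: (s).
  (* The new first arc, moved by one period, is the second half of the old last arc. *)
  rewrite -vE -(@arc_loss_shift b)// ?(ltW bP) ?(ltW hP)//.
  have -> : chain_loss (rcons s (b + P)) = chain_loss (rcons s1 u) + lam u (b + P).
    by rewrite sE chain_loss_rcons.
  by have := arc_loss_split F Q S u (b + P) (head 0 s + P); lra.
Qed.

(* The directions b and w bound a null sector, possibly across the direction 0. *)
Definition same_ray b w := [\/ F b = F w, F b = F w + F P | F w = F b + F P].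

Lemma cumulative0 : F 0 = 0.
Proof. by have := FP (lexx 0) (ltW P0); rewrite add0r; lra. Qed.

(** The ray [w] lies outside the open arc that receives [b]. So the null sector between them covers
    the part of the arc between the lift of [b] and one end of the arc. *)
Lemma insertion_gain_same_ray s b w : angle_list s -> 0 <= b < P -> w \in s ->
  same_ray b w -> insertion_gain s b = 0.
Proof.
move=> sA bP ws bw; have [|u [v [b' [sg bl ub bv]]]] := lift_gap sA _ bP.
  by case: (s) ws.
rewrite (insertion_gainE sA sg bP bl ub bv).
have [us uv vh /(_ w ws) wuv] := gapP sA sg.
have [u0 uP _ v2 /(_ w ws) vw] := gap_bounds sA sg.
have /andP[w0 wP] := sA.1 _ ws; case/andP: bP => b0 bP.
have f0 := cumulative0; have P' := P0.
apply: (split_gain_null F_homo affP) => //.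
have Fw : F (w + P) = F w + F P by rewrite FP//; lra.
have Fub' : F u <= F b' by apply: F_homo => //; lra.
have Fbv' : F b' <= F v by apply: F_homo => //; lra.
have Fu0 : F 0 <= F u by apply: F_homo => //; lra.
have Fw0 : F 0 <= F w by apply: F_homo => //; lra.
have FwP : F w <= F P by apply: F_homo => //; lra.
have FuP : F u <= F P by apply: F_homo => //; lra.
have Fb0 : F 0 <= F b by apply: F_homo => //; lra.
have FbP : F b <= F P by apply: F_homo => //; lra.
have Fvw : F v <= F (w + P) by apply: F_homo => //; lra.
case: bl => bb; subst b'.
- case: wuv => [wu|vw'].
    have Fwu : F w <= F u by apply: F_homo => //; lra.
    by case: bw => bw; [left|right|left]; lra.
  have Fvw' : F v <= F w by apply: F_homo => //; lra.
  by case: bw => bw; [right|right|left]; lra.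
- have wu : w <= u by case: wuv => //; lra.
  have Fwu : F w <= F u by apply: F_homo => //; lra.
  have Fb : F (b + P) = F b + F P by rewrite FP//; lra.
  by case: bw => bw; [right|left|left]; lra.
Qed.

Lemma insertion_gain_ge0 s b : angle_list s -> s != [::] -> 0 <= b < P ->
  0 <= insertion_gain s b.
Proof.
move=> sA s0 bP; have [u [v [b' [sg bl ub bv]]]] := lift_gap sA s0 bP.
rewrite (insertion_gainE sA sg bP bl ub bv).
by have [u0 uP uv v2 _] := gap_bounds sA sg; apply: (split_gain_ge0 F_homo affP).
Qed.

Lemma unrolled_break t' : t' \in unrolled_breaks P ts ->
  exists2 t, t \in ts & angle_lift t t'.
Proof.
rewrite mem_cat => /orP[t't|/mapP[t tts ->]]; first by exists t'; [|left].
by exists t; [|right].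
Qed.

Lemma insertion_gain_improve s b : angle_list s -> s != [::] -> 0 <= b < P ->
  0 < insertion_gain s b ->
  exists2 t, t \in ts & insertion_gain s b < insertion_gain s t \/
    insertion_gain s b = insertion_gain s t /\ same_ray b t.
Proof.
move=> sA s0 bP; have [u [v [b' [sg bl ub bv]]]] := lift_gap sA s0 bP.
rewrite (insertion_gainE sA sg bP bl ub bv) => g0.
have [u0 uP uv v2 _] := gap_bounds sA sg.
have [t' t'B [/andP[ut tv] H]] := split_gain_improve F_homo affP u0 uv v2 ub bv g0.
have [t tts tl] := unrolled_break t'B; have tP := tsP tts.
exists t => //; rewrite (insertion_gainE sA sg tP tl (ltW ut) (ltW tv)).
case: H => [|[? Ftb]]; first by left.
right; split=> //; case/andP: tP => t0 /ltW tP; case/andP: bP => b0 /ltW bP.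
case: bl tl => [->|->] [->|->] in Ftb *; move: Ftb; rewrite ?FP// => Ftb;
  [apply: Or31|apply: Or32|apply: Or33|apply: Or31]; lra.
Qed.

Lemma cyclic_loss_improve s : angle_list s -> s != [::] -> 0 < cyclic_loss s ->
  exists2 t, t \in ts & 0 < insertion_gain s t.
Proof.
move=> sA s0 loss0.
have [/hasP[t tts gt]|/hasPn hB] := boolP (has (fun t => 0 < insertion_gain s t) ts).
  by exists t.
suff gap0 u v : cyclic_gap s u v -> lam u v = 0.
  suff c0 s1 s2 : unrolled s = s1 ++ s2 -> chain_loss s2 = 0.
    by move: loss0; rewrite /cyclic_loss (c0 [::])// ltxx.
  elim: s2 s1 => [//|u [//|v s2] IHs] s1 E.
  rewrite /= gap0 ?add0r; last by exists s1, s2.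
  by apply: (IHs (rcons s1 u)); rewrite cat_rcons.
move=> sg; have [u0 uP uv v2 _] := gap_bounds sA sg.
apply: (arc_loss_eq0 F_homo affP) => // t' t'B /andP[ut tv].
have [t tts tl] := unrolled_break t'B; have tP := tsP tts.
rewrite -(insertion_gainE sA sg tP tl (ltW ut) (ltW tv)).
by have := hB _ tts; rewrite -leNgt.
Qed.

(** A single ray bounds an arc of a full period, whose integrals do not depend on where it
    starts. *)
Lemma cyclic_loss1 a b : 0 <= a < P -> 0 <= b < P ->
  cyclic_loss [:: a] = cyclic_loss [:: b].
Proof.
move=> /andP[a0 /ltW aP] /andP[b0 /ltW bP]; rewrite /cyclic_loss /= !addr0.
rewrite /arc_loss !FP// !QP//.
have H : forall x y : R, x + y - x = y by move=> *; ring.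
rewrite !H; congr (_ - _); apply: eq_bigr => k _.
by rewrite !SP// !H.
Qed.

End CyclicLoss.

(** * The single pass *)

Section CoordinatePass.
Variables (R : realType) (M K : nat) (F Q : R -> R) (S : 'I_K -> R -> R).
Variables (phis : 'I_M -> R) (alpha : R) (l : ('I_M -> R) -> R).
Local Notation P := (2 * @pi R).
Local Notation ts := (codom phis).
Local Notation cl := (cyclic_loss P F Q S).
Local Notation gain := (insertion_gain P F Q S).
Hypothesis F_homo : forall u v : R, 0 <= u -> u <= v -> v <= P + P -> F u <= F v.
Hypothesis affP : affine_between_breaks P F Q S ts.
Hypothesis FP : forall x : R, 0 <= x -> x <= P -> F (x + P) = F x + F P.
Hypothesis QP : forall x : R, 0 <= x -> x <= P -> Q (x + P) = Q x + Q P.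
Hypothesis SP : forall k (x : R), 0 <= x -> x <= P -> S k (x + P) = S k x + S k P.
Hypothesis phisP : angle_box R M phis.
Hypothesis alpha0 : 0 < alpha.
Hypothesis lE : forall phi, angle_box R M phi ->
  l phi = alpha * cl (sort <=%R (codom phi)).
Hypothesis l0 : forall phi, 0 <= l phi.

Definition other_angles (phi : 'I_M -> R) (j : 'I_M) : seq R :=
  sort <=%R [seq phi i | i <- enum (predC1 j)].

Let P0 : 0 < P. Proof. by rewrite mulr_gt0// pi_gt0. Qed.

Let tsP t : t \in ts -> 0 <= t < P.
Proof. by case/codomP => i ->; exact: phisP. Qed.

Lemma angles_sort (s : seq R) : (forall t, t \in s -> 0 <= t < P) ->
  angle_list P (sort <=%R s).
Proof.
move=> sP; split; last by apply: sort_sorted; exact: le_total.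
by move=> t; rewrite mem_sort; exact: sP.
Qed.

Lemma sort_codom_set_angle (phi : 'I_M -> R) j b :
  sort <=%R (codom (set_angle phi j b)) = sort <=%R (b :: other_angles phi j).
Proof.
apply/(perm_sortP le_total le_trans le_anti).
apply: (@perm_trans _ (b :: [seq phi i | i <- enum (predC1 j)])); last first.
  by rewrite perm_cons perm_sym perm_sort.
have -> : b :: [seq phi i | i <- enum (predC1 j)] =
    [seq set_angle phi j b i | i <- j :: enum (predC1 j)].
  rewrite /= {1}/set_angle eqxx; congr (_ :: _); apply/eq_in_map => i.
  by rewrite mem_enum inE /set_angle => /negPf ->.
apply: perm_map; apply: uniq_perm; first exact: enum_uniq.
  by rewrite /= enum_uniq mem_enum inE eqxx.
by move=> i; rewrite in_cons !mem_enum !inE; case: eqP.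
Qed.

Lemma other_anglesP phi j : angle_box R M phi -> angle_list P (other_angles phi j).
Proof.
by move=> phiP; apply: angles_sort => t /mapP[i _ ->]; exact: phiP.
Qed.

Lemma mem_other_angles phi (i j : 'I_M) : i != j -> phi i \in other_angles phi j.
Proof. by move=> ij; rewrite mem_sort map_f// mem_enum inE. Qed.

Lemma set_angle_box phi j b : angle_box R M phi -> angle_range R b ->
  angle_box R M (set_angle phi j b).
Proof. by move=> phiP bP i; rewrite /set_angle; case: eqP. Qed.

(** Minimizing over one angle thus means maximizing the insertion gain into the other rays. *)
Lemma loss_set_angle phi j b : angle_box R M phi -> angle_range R b ->
  l (set_angle phi j b) =
  alpha * (cl (other_angles phi j) - gain (other_angles phi j) b).
Proof.
move=> phiP bP; rewrite lE; last exact: set_angle_box.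
by rewrite sort_codom_set_angle /insertion_gain opprB addrCA subrr addr0.
Qed.

Lemma same_ray_sym b w : same_ray P F b w -> same_ray P F w b.
Proof. by case=> H; [apply: Or31|apply: Or33|apply: Or32]. Qed.

(** A positive gain is always matched or exceeded at one of the finitely many true rays, so the best
    of these is a minimizer. No continuity or compactness is involved. *)
Lemma angle_argmin_exists phi j : angle_box R M phi -> exists a : R,
  argmin_on (angle_range R) (fun b => l (set_angle phi j b)) a.
Proof.
move=> phiP; have sA := other_anglesP j phiP.
have zP : angle_range R 0 by rewrite /angle_range/= lexx P0.
(* This is the case [M = 1], where the loss does not depend on the angle. *)
have [s0|s0] := eqVneq (other_angles phi j) [::].
  exists 0; split=> // y yP; rewrite !loss_set_angle// s0 /insertion_gain.
  by rewrite (cyclic_loss1 FP QP SP zP yP).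
(* If no gain is positive, all gains are 0 and every angle is a minimizer. *)
have [[b bP gb]|nob] := pselect (exists2 b, angle_range R b &
    0 < gain (other_angles phi j) b); last first.
  exists 0; split=> // y yP; rewrite !loss_set_angle// ler_pM2l// lerD2l lerN2.
  rewrite (@le_trans _ _ 0)//; last first.
    exact: (insertion_gain_ge0 F_homo affP FP QP SP).
  by rewrite leNgt; apply/negP => gy; apply: nob; exists y.
have [t tts tb] := insertion_gain_improve F_homo affP FP QP SP tsP sA s0 bP gb.
have [i0 _] := codomP tts.
case: (@Order.TotalTheory.arg_maxP _ _ _ i0 xpredT
  (fun i => gain (other_angles phi j) (phis i)) isT) => i _ imax.
exists (phis i); split; first exact: phisP.
move=> y yP; rewrite !loss_set_angle//.
rewrite ler_pM2l// lerD2l lerN2.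
have imax' t' : t' \in ts ->
    gain (other_angles phi j) t' <= gain (other_angles phi j) (phis i).
  by case/codomP => i' ->; exact: imax.
have [gy|gy] := ltP 0 (gain (other_angles phi j) y).
  have [t' t'ts t'y] := insertion_gain_improve F_homo affP FP QP SP tsP sA s0 yP gy.
  by rewrite (le_trans _ (imax' _ t'ts))//; case: t'y => [/ltW|[->]].
rewrite (le_trans gy)//; apply: (insertion_gain_ge0 F_homo affP FP QP SP) => //.
exact: phisP.
Qed.

(** * Progress along the pass *)

Section Pass.
Variable t : nat -> 'I_M -> R.
Hypothesis pass : coordinate_pass l t.

Lemma pass_box k : (k <= M)%N -> angle_box R M (t k).
Proof.
case: pass => t0 tS; elim: k => [_|k IHk kM].
  by rewrite t0 => j; rewrite /angle_range/= lexx P0.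
have [a [aP _] /= ->] := tS (Ordinal kM).
by apply: set_angle_box => //; exact/IHk/ltnW.
Qed.

Lemma pass_unvisited k (j : 'I_M) : (k <= j)%N -> t k j = 0.
Proof.
case: pass => t0 tS; elim: k => [_|k IHk kj]; first by rewrite t0.
have kM := ltn_trans kj (ltn_ord j).
have [a _ /= ->] := tS (Ordinal kM); rewrite /set_angle.
by case: eqP kj => [->|_ /ltnW/IHk//]; rewrite ltnn.
Qed.

(** Indices of true rays are collected, not updates, since one update may hit several true rays that
    agree up to null sectors. *)
Definition covered k : {set 'I_M} :=
  [set i | [exists j : 'I_M, (j < k)%N && `[< same_ray P F (t k j) (phis i) >]]].

Lemma coveredP k i : reflect
  (exists2 j : 'I_M, (j < k)%N & same_ray P F (t k j) (phis i)) (i \in covered k).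
Proof.
rewrite inE; apply: (iffP existsP) => [[j /andP[jk /asboolP]]|[j jk jr]].
  by exists j.
by exists j; rewrite jk; exact/asboolP.
Qed.

Lemma pass_step (j : 'I_M) : l (t j.+1) <= l (t j) /\
  forall y, angle_range R y -> l (t j.+1) <= l (set_angle (t j) j y).
Proof.
have [a [aP amin] ->] := pass.2 j.
have jbox := pass_box (ltnW (ltn_ord j)).
suff E : t j = set_angle (t j) j (t j j).
  by split=> //; rewrite [leRHS](congr1 l E); apply: amin; exact: jbox.
by apply/funext => i; rewrite /set_angle; case: eqP => [->|].
Qed.

(** As angle [j.+1] is still 0, taking out angle [j] does not change the loss. A positive loss gives
    some true ray a positive gain, so the minimizer has a positive gain too and agrees with a true
    ray. That ray is new, since a ray already covered has gain 0. *)
Lemma covered_step (j : 'I_M) : (j.+1 < M)%N -> 0 < l (t j) ->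
  (#|covered j| < #|covered j.+1|)%N.
Proof.
move=> jM lj; have [a [aP amin] tE] := pass.2 j.
have jbox := pass_box (ltnW (ltn_ord j)).
set s := other_angles (t j) j; have sA : angle_list P s by exact: other_anglesP.
have zP : angle_range R 0 by rewrite /angle_range/= lexx P0.
have zs : 0 \in s.
  rewrite -(@pass_unvisited j (Ordinal jM) (leqnSn j)); apply: mem_other_angles.
  by rewrite -val_eqE /= gtn_eqF.
have s0 : s != [::] by case: (s) zs.
have same0 b w : angle_range R b -> w \in s -> same_ray P F b w -> gain s b = 0.
  by move=> bP ws; exact: (insertion_gain_same_ray P0 F_homo affP FP QP SP).
have ljE : l (t j) = alpha * cl s.
  have -> : t j = set_angle (t j) j 0.
    by apply/funext => i; rewrite /set_angle; case: eqP => // ->; exact: pass_unvisited.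
  by rewrite loss_set_angle// (same0 0 0) ?subr0//; exact: Or31.
have [t1 t1ts gt1] : exists2 t1, t1 \in ts & 0 < gain s t1.
  apply: (cyclic_loss_improve F_homo affP FP QP SP tsP sA s0).
  by rewrite -(pmulr_rgt0 _ alpha0) -ljE.
have gmax y : angle_range R y -> gain s y <= gain s a.
  move=> yP; have := amin y yP; rewrite !loss_set_angle//.
  by rewrite ler_pM2l// lerD2l lerN2.
have ga : 0 < gain s a by rewrite (lt_le_trans gt1)// gmax//; exact: tsP.
have [t2 t2ts] := insertion_gain_improve F_homo affP FP QP SP tsP sA s0 aP ga.
case=> [|[at2 srt2]]; first by rewrite ltNge gmax//; exact: tsP.
have [i t2E] := codomP t2ts.
apply: proper_card; apply/properP; split.
  apply/fintype.subsetP => i' /coveredP[j' j'j srj']; apply/coveredP.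
  exists j'; first by rewrite ltnS ltnW.
  by rewrite tE /set_angle -val_eqE ltn_eqF.
exists i; first by apply/coveredP; exists j; rewrite // tE /set_angle eqxx -t2E.
(* An earlier angle on the same ray would be among the remaining rays [s] and make the gain
   vanish. *)
apply/negP => /coveredP[j' j'j srj'].
have := same0 t2 (t j j') (tsP t2ts).
rewrite -at2 => g0; move: ga; rewrite g0 ?ltxx//.
  by apply: mem_other_angles; rewrite -val_eqE ltn_eqF.
by rewrite t2E; exact: same_ray_sym.
Qed.

Lemma pass_covered k : (k < M)%N -> l (t k) = 0 \/ (k <= #|covered k|)%N.
Proof.
elim: k => [_|k IHk kM]; first by right.
have kM' := ltnW kM; pose j := Ordinal kM'.
have [lt0|kcov] := IHk kM'.
  by left; apply/eqP; rewrite eq_le l0 andbT -lt0; case: (pass_step j).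
have [lk|lk] := eqVneq (l (t k)) 0.
  by left; apply/eqP; rewrite eq_le l0 andbT -lk; case: (pass_step j).
right; apply: leq_ltn_trans kcov _; apply: (@covered_step j) => //=.
by rewrite lt_neqAle eq_sym lk l0.
Qed.

(** The last minimizer itself is not identified. Its loss is at most that of choosing the one true
    ray possibly left uncovered, and with that choice every true ray has gain 0, which forces loss
    zero. *)
Lemma pass_loss0 : (0 < M)%N -> l (t M) = 0.
Proof.
move=> M0; have jM : (M.-1 < M)%N by rewrite prednK.
pose j := Ordinal jM.
have [lej minj] := pass_step j; rewrite /= prednK// in lej minj.
apply/eqP; rewrite eq_le l0 andbT.
have [lt0|cov] := pass_covered jM; first by rewrite -lt0.
have jbox := pass_box (ltnW jM).
(* Two uncovered indices would contradict the lower bound [M - 1] on the number of covered ones; if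
   all are covered, any index serves as [i0]. *)
have [i0 i0P] : exists i0, forall i, i != i0 -> i \in covered M.-1.
  have [c0|[i0 i0c]] := set_0Vmem (~: covered M.-1).
    by exists j => i _; rewrite -[i \in _]negbK -finset.in_setC c0 inE.
  exists i0 => i ii0; rewrite -[i \in _]negbK -finset.in_setC; apply/negP => ic.
  have : (#|[set i; i0]%SET| <= #|~: covered M.-1|)%N.
    apply: subset_leq_card; apply/fintype.subsetP => i'.
    by rewrite finset.in_set2 => /orP[]/eqP->.
  rewrite cards2 ii0 cardsCs finset.setCK card_ord; move: cov; lia.
apply: le_trans (minj (phis i0) (phisP i0)) _.
rewrite lE; last by apply: set_angle_box => //; exact: phisP.
rewrite sort_codom_set_angle pmulr_rle0// leNgt; apply/negP => loss0.
set s := sort _ _ in loss0; have sA : angle_list P s.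
  apply: angles_sort => w; rewrite inE => /predU1P[->|]; first exact: phisP.
  by have [H _] := other_anglesP j jbox; exact: H.
have mems w : w \in phis i0 :: other_angles (t M.-1) j -> w \in s.
  by rewrite mem_sort.
have s0 : s != [::] by case: (s) (mems _ (mem_head _ _)).
have [t1 /codomP[i ->]] :=
  cyclic_loss_improve F_homo affP FP QP SP tsP sA s0 loss0.
suff [w ws wi] : exists2 w, w \in s & same_ray P F (phis i) w.
  rewrite (insertion_gain_same_ray P0 F_homo affP FP QP SP sA _ ws wi) ?ltxx//.
  exact: phisP.
have [->|/i0P/coveredP[j' j'j srj']] := eqVneq i i0.
  by exists (phis i0); [apply: mems; rewrite mem_head | exact: Or31].
exists (t M.-1 j'); last exact: same_ray_sym.
apply: mems; rewrite inE mem_other_angles ?orbT//.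
by rewrite -val_eqE ltn_eqF.
Qed.

Lemma pass_argmin : (0 < M)%N -> argmin_on (angle_box R M) l (t M).
Proof.
by move=> M0; split; [exact: pass_box|move=> phi _; rewrite pass_loss0].
Qed.

End Pass.
End CoordinatePass.

(** * Polar angles *)

Section PolarAngle.
Variable R : realType.
Implicit Types (x z : R * R) (t u v : R).
Local Notation P := (2 * @pi R).

Lemma cosD_2pi t : cos (t + P) = cos t.
Proof. by rewrite [P]mulr_natl cosD2pi. Qed.

Lemma sinD_2pi t : sin (t + P) = sin t.
Proof. by rewrite [P]mulr_natl sinD2pi. Qed.

(** By evenness take [t] nonnegative; then [cos t] is 1 minus twice the square of [sin (t / 2)], and
    this sine is positive for [0 < t < P]. *)
Lemma cos_eq1 t : `|t| < P -> cos t = 1 -> t = 0.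
Proof.
wlog t0 : t / 0 <= t => [H|].
  have [/H//|t0] := leP 0 t; rewrite -(normrN t) -(cosN t) => tP ct.
  have nt0 : 0 <= - t by rewrite oppr_ge0 ltW.
  by apply: oppr_inj; rewrite oppr0 (H _ nt0 tP ct).
rewrite ger0_norm// => tP ct; apply/eqP; rewrite eq_le t0 andbT leNgt.
apply/negP => t0'.
have s0 : 0 < sin (t / 2) by apply: sin_gt0_pi; apply/andP; split; lra.
have := cos_mulr2n (t / 2); rewrite cos2sin2 (_ : t / 2 *+ 2 = t); last by lra.
by have := exprn_gt0 2 s0; rewrite ct; lra.
Qed.

Lemma polar_inj r r' t t' : 0 < r -> 0 < r' -> `|t - t'| < P ->
  r * cos t = r' * cos t' -> r * sin t = r' * sin t' -> t = t'.
Proof.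
move=> r0 r'0 tt' Ec Es.
have rr' : r = r'.
  apply/eqP; rewrite -(eqrXn2 (n := 2)) ?ltW//; apply/eqP.
  rewrite -[LHS]mulr1 -[RHS]mulr1 -{1}(cos2Dsin2 t) -(cos2Dsin2 t').
  by rewrite !mulrDr -!exprMn Ec Es.
move: Ec Es; rewrite rr' => /(mulfI (lt0r_neq0 r'0)) Ec /(mulfI (lt0r_neq0 r'0)) Es.
apply/eqP; rewrite -subr_eq0; apply/eqP; apply: cos_eq1 => //.
by rewrite cosB Ec Es -!expr2 cos2Dsin2.
Qed.

Definition radius x z : R :=
  Num.sqrt ((z.1 - x.1) ^+ 2 + (z.2 - x.2) ^+ 2).

(** [acos] gives the angle in the closed upper half-plane, and the open lower one is reflected. The
    value at the vertex is meaningless. *)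
Definition polar_angle x z : R :=
  let a := acos ((z.1 - x.1) / radius x z) in
  if 0 <= z.2 - x.2 then a else P - a.

Lemma radius_gt0 x z : z != x -> 0 < radius x z.
Proof.
move=> zx; rewrite sqrtr_gt0 lt_neqAle addr_ge0 ?sqr_ge0// andbT eq_sym.
apply: contra zx; rewrite paddr_eq0 ?sqr_ge0// !sqrf_eq0 !subr_eq0.
by case: x z => [? ?] [? ?] /= /andP[/eqP-> /eqP->].
Qed.

Lemma sqr_radius x z : radius x z ^+ 2 = (z.1 - x.1) ^+ 2 + (z.2 - x.2) ^+ 2.
Proof. by rewrite sqr_sqrtr// addr_ge0 ?sqr_ge0. Qed.

Lemma cos_ratio x z : z != x -> -1 <= (z.1 - x.1) / radius x z <= 1.
Proof.
move=> zx; have r0 := radius_gt0 zx.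
rewrite -ler_norml normrM normfV (gtr0_norm r0) ler_pdivrMr// mul1r.
rewrite -(ler_pXn2r (n := 2)) ?nnegrE ?(ltW r0)// sqr_radius real_normK ?num_real//.
by rewrite lerDl sqr_ge0.
Qed.

Lemma polar_angleP x z : z != x ->
  [/\ 0 <= polar_angle x z < P,
      z.1 - x.1 = radius x z * cos (polar_angle x z) &
      z.2 - x.2 = radius x z * sin (polar_angle x z)].
Proof.
move=> zx; have r0 := radius_gt0 zx; have zr := cos_ratio zx.
have [/andP[a0 api] ca] := acos_def zr; rewrite /polar_angle.
set a := acos _ in a0 api ca *.
have X : z.1 - x.1 = radius x z * cos a.
  by rewrite ca mulrC divfK// gt_eqF.
have sa : 0 <= sin a by rewrite sin_ge0_pi// a0.
have Y2 : (z.2 - x.2) ^+ 2 = (radius x z * sin a) ^+ 2.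
  rewrite exprMn sin2cos2 mulrBr mulr1 -exprMn -X sqr_radius; ring.
have rsa : 0 <= radius x z * sin a by rewrite mulr_ge0// ltW.
have pi0 := pi_gt0 R.
case: ifPn => [Y0|]; last rewrite -ltNge => Y0.
  split=> //; first by rewrite a0 /=; lra.
  by apply/eqP; rewrite -(eqrXn2 (n := 2))//; exact/eqP.
have E : z.2 - x.2 = - (radius x z * sin a).
  apply/eqP; rewrite -eqr_oppLR -(eqrXn2 (n := 2)) ?oppr_ge0 ?(ltW Y0)//.
  by rewrite sqrrN; exact/eqP.
(* This keeps [P - a] strictly below [P]. *)
have a_gt0 : 0 < a.
  rewrite lt_neqAle a0 andbT; apply/eqP => a_eq0; move: E Y0.
  by rewrite -a_eq0 sin0 mulr0 oppr0 => ->; rewrite ltxx.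
split; first by apply/andP; split; lra.
  by rewrite [P - a]addrC cosD_2pi cosN.
by rewrite [P - a]addrC sinD_2pi sinN mulrN.
Qed.

(** Since [cos] decreases on [[0, pi]], the comparison of angles becomes one between coordinates and
    radius, from which measurability follows. The next lemma does the same beyond [pi]. *)
Lemma polar_angle_lt_le_pi x z t : z != x -> 0 <= t <= pi ->
  (polar_angle x z < t) =
  (0 <= z.2 - x.2) && (radius x z * cos t < z.1 - x.1).
Proof.
move=> zx /andP[t0 tpi]; have r0 := radius_gt0 zx; have zr := cos_ratio zx.
have [/andP[a0 api] ca] := acos_def zr; rewrite /polar_angle.
set a := acos _ in a0 api ca *.
case: ifPn => Y0 /=; last by apply/negP; lra.
rewrite [radius _ _ * cos _]mulrC -ltr_pdivlMr// -ca ltr_cos// in_itv/= ?t0//.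
by rewrite a0.
Qed.

Lemma polar_angle_lt_gt_pi x z t : z != x -> pi < t <= P ->
  (polar_angle x z < t) =
  (0 <= z.2 - x.2) || (z.1 - x.1 < radius x z * cos t).
Proof.
move=> zx /andP[tpi tP]; have r0 := radius_gt0 zx; have zr := cos_ratio zx.
have [/andP[a0 api] ca] := acos_def zr; rewrite /polar_angle.
set a := acos _ in a0 api ca *.
case: ifPn => Y0 /=; first by rewrite (le_lt_trans api).
rewrite [radius _ _ * cos _]mulrC -ltr_pdivrMr// -ca.
have -> : cos t = cos (P - t).
  by rewrite -[RHS]cosN opprB -[in RHS]cosD_2pi subrK.
by rewrite ltr_cos ?in_itv/= ?a0//; apply/idP/idP; lra.
Qed.

Definition angle_below x t z : bool := (z != x) && (polar_angle x z < t).

Lemma measurable_angle_below x t :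
  measurable_fun [set: measurableTypeR R * measurableTypeR R] (angle_below x t).
Proof.
pose T : measurableType _ := (measurableTypeR R * measurableTypeR R)%type.
have mX : measurable_fun [set: T] (fun z : T => z.1 - x.1 : R).
  by apply: measurable_funB => //; exact: measurable_fst.
have mY : measurable_fun [set: T] (fun z : T => z.2 - x.2 : R).
  by apply: measurable_funB => //; exact: measurable_snd.
have mr : measurable_fun [set: T] (radius x : T -> R).
  apply: (@measurableT_comp _ _ _ _ _ _ (@Num.sqrt R)).
    by apply: continuous_measurable_fun; exact: sqrt_continuous.
  by apply: measurable_funD; apply: measurable_funX.
have mrt : measurable_fun [set: T] (fun z : T => radius x z * cos t : R).
  exact: measurable_funM.
have mne : measurable_fun [set: T] (fun z : T => z != x).
  rewrite (_ : (fun _ => _) = fun z : T => ~~ ((z.1 - x.1 == 0) && (z.2 - x.2 == 0))).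
    by apply: measurable_neg; apply: measurable_and; apply: measurable_fun_eqr.
  apply/funext => z; rewrite !subr_eq0; case: (z) => [a b].
  by case: (x) => [c d] /=; rewrite xpair_eqE.
have mY0 : measurable_fun [set: T] (fun z : T => 0 <= z.2 - x.2).
  exact: measurable_fun_ler.
have [t0|t0] := leP t 0.
  rewrite (_ : angle_below x t = cst false); first exact: measurable_cst.
  apply/funext => z /=; apply/negP => /andP[zx].
  have [/andP[a0 _] _ _] := polar_angleP zx.
  by rewrite ltNge (le_trans t0).
have [tpi|tpi] := leP t pi.
  rewrite (_ : angle_below x t = fun z : T => (z != x) &&
     ((0 <= z.2 - x.2) && (radius x z * cos t < z.1 - x.1))); last first.
    apply/funext => z; apply: andb_id2l => zx.
    by rewrite polar_angle_lt_le_pi// (ltW t0).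
  apply: measurable_and => //; apply: measurable_and => //.
  exact: measurable_fun_ltr.
have [tP|tP] := leP t P.
  rewrite (_ : angle_below x t = fun z : T => (z != x) &&
     ((0 <= z.2 - x.2) || (z.1 - x.1 < radius x z * cos t))); last first.
    apply/funext => z; apply: andb_id2l => zx.
    by rewrite polar_angle_lt_gt_pi// tpi.
  apply: measurable_and => //; apply: measurable_or => //.
  exact: measurable_fun_ltr.
rewrite (_ : angle_below x t = fun z : T => (z != x))//.
apply/funext => z; apply: andb_idr => zx.
by have [/andP[_ aP] _ _] := polar_angleP zx; rewrite (lt_trans aP).
Qed.

Definition in_lift x u v z :=
  (u <= polar_angle x z < v) || (u <= polar_angle x z + P < v).

(** The parameter of a point of the sector lies in [[0, P + P)], so it is the polar angle or the
    polar angle plus [P]. *)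
Lemma angle_sectorP x u v z : 0 <= u -> v <= P + P ->
  angle_sector x u v z <-> z != x /\ in_lift x u v z.
Proof.
move=> u0 v2; have pi0 := pi_gt0 R; split.
  move=> [r [t [r0 /andP[ut tv] zE]]].
  have zx : z != x.
    rewrite zE; apply/eqP; case: x {zE} => x1 x2 -[Ec Es].
    have /eqP : r * cos t = 0 by lra.
    have /eqP : r * sin t = 0 by lra.
    rewrite !mulf_eq0 (gt_eqF r0) /= => /eqP s0 /eqP c0; have := cos2Dsin2 t.
    by rewrite c0 s0 expr0n addr0 => /eqP; rewrite eq_sym oner_eq0.
  split=> //; have [/andP[a0 aP] X Y] := polar_angleP zx.
  have ang t' : cos t' = cos t -> sin t' = sin t -> `|t' - polar_angle x z| < P ->
      polar_angle x z = t'.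
    move=> ct st tt'; apply/esym/(polar_inj r0 (radius_gt0 zx) tt').
      by rewrite -X ct zE /= addrAC subrr add0r.
    by rewrite -Y st zE /= addrAC subrr add0r.
  have [tP|tP] := ltP t P.
    by rewrite /in_lift (ang t)// ?ut ?tv// ltr_norml; apply/andP; split; lra.
  rewrite /in_lift (ang (t - P)) ?subrK ?ut ?tv ?orbT//.
  - by rewrite -cosD_2pi subrK.
  - by rewrite -sinD_2pi subrK.
  - by rewrite ltr_norml; apply/andP; split; lra.
move=> [zx zl]; have [/andP[a0 aP] X Y] := polar_angleP zx.
case/orP: zl => zl; exists (radius x z); [exists (polar_angle x z) |
  exists (polar_angle x z + P)]; (split; [exact: radius_gt0 | by []|]);
  by rewrite ?cosD_2pi ?sinD_2pi -X -Y; case: z {zl zx a0 aP X Y} => ? ? /=;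
    congr (_, _); ring.
Qed.

(* The number of lifts in [0, t) to the real line of the angle of z, for
   0 <= t <= 4 pi. *)
Definition lift_count x t z : R :=
  (angle_below x t z)%:R + (angle_below x (t - P) z)%:R.

Lemma measurable_lift_count x t :
  measurable_fun [set: measurableTypeR R * measurableTypeR R] (lift_count x t).
Proof.
have mb u : measurable_fun [set: measurableTypeR R * measurableTypeR R]
    (fun z => (angle_below x u z)%:R : R).
  rewrite (_ : (fun _ => _) = fun z => if angle_below x u z then 1 else 0 : R).
    by apply: measurable_fun_ifT => //; exact: measurable_angle_below.
  by apply/funext => z; case: ifP.
exact: measurable_funD.
Qed.

Lemma lift_count_homo x u v z : u <= v -> lift_count x u z <= lift_count x v z.
Proof.
move=> uv; apply: lerD; rewrite ler_nat /angle_below; case: (z != x) => //=.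
  by have [zu|//] := boolP (_ < u); rewrite (lt_le_trans zu).
have [zu|//] := boolP (_ < u - _); rewrite (lt_le_trans zu)//.
by rewrite lerD2r.
Qed.

Lemma lift_count_ge0 x t z : 0 <= lift_count x t z.
Proof. by rewrite addr_ge0. Qed.

Lemma lift_count_le2 x t z : lift_count x t z <= 2.
Proof.
by rewrite /lift_count -natrD ler_nat; case: angle_below; case: angle_below.
Qed.

(** An interval of length at most [P] contains at most one of the two lifts, so the difference is 0
    or 1. *)
Lemma lift_countB x u v z : u <= v -> v <= u + P ->
  lift_count x v z - lift_count x u z = ((z != x) && in_lift x u v z)%:R.
Proof.
move=> uv vP; rewrite /lift_count /angle_below /in_lift.
case: (z != x) => /=; last by rewrite subrr.
rewrite !ltrBrDr.
case: (leP u (polar_angle x z)); case: (ltP (polar_angle x z) v);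
  case: (leP u (polar_angle x z + P)); case: (ltP (polar_angle x z + P) v) => /=;
  move=> *; lra.
Qed.

Lemma lift_countD x t z : 0 <= t -> t <= P ->
  lift_count x (t + P) z = lift_count x t z + lift_count x P z.
Proof.
move=> t0 tP; rewrite /lift_count /angle_below addrK subrr.
have [zx|zx] /= := boolP (z != x); last by rewrite !addr0.
have [/andP[a0 aP] _ _] := polar_angleP zx.
rewrite aP [_ < 0]ltNge a0 [_ < t + P](lt_le_trans aP) ?lerDr//.
by rewrite [_ < t - P]ltNge (_ : t - P <= _) /=; lra.
Qed.

Lemma indic_angle_sector x u v z : 0 <= u -> u <= v -> v <= u + P -> v <= P + P ->
  \1_(angle_sector x u v) z = lift_count x v z - lift_count x u z.
Proof.
move=> u0 uv vuP v2; rewrite lift_countB// indicE; congr (_%:R); congr nat_of_bool.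
by apply/idP/andP => [|?]; rewrite inE angle_sectorP.
Qed.

End PolarAngle.

(** * Wedges *)

Lemma cyclic_lossE (R : realFieldType) (K : nat) (P : R) (F Q : R -> R)
    (S : 'I_K -> R -> R) (s : seq R) :
  cyclic_loss P F Q S s = \sum_(j < size s)
    arc_loss F Q S (nth 0 s j)
      (if (j.+1 < size s)%N then nth 0 s j.+1 else nth 0 s 0 + P).
Proof.
have pathE x s' : path_loss F Q S x s' = \sum_(j < size s')
    arc_loss F Q S (nth 0 (x :: s') j) (nth 0 s' j).
  elim: s' x => [|y s' IHs] x; first by rewrite big_ord0.
  by rewrite big_ord_recl /= IHs.
case: s => [|x s]; first by rewrite big_ord0.
rewrite /cyclic_loss /unrolled /= pathE size_rcons.
apply: eq_bigr => -[j /= jS] _; congr (arc_loss _ _ _ _ _).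
  by rewrite -rcons_cons nth_rcons ifT.
rewrite nth_rcons ltnS; case: ltnP => // sj.
by rewrite ifT// eqn_leq sj andbT -ltnS.
Qed.

Section Wedges.
Variables (R : realType) (M : nat) (x : R * R) (phi : 'I_M -> R).
Hypothesis phiP : angle_box R M phi.
Local Notation P := (2 * @pi R).
Local Notation s := (sorted_angles phi).

Lemma size_sorted_angles : size s = M.
Proof. by rewrite size_sort size_codom card_ord. Qed.

Lemma sorted_anglesP : angle_list P s.
Proof.
split; last by apply: sort_sorted; exact: le_total.
by move=> t; rewrite mem_sort => /codomP[i ->]; exact: phiP.
Qed.

Lemma nth_sorted_angles j : (j < M)%N -> nth 0 s j \in codom phi.
Proof.
move=> jM; have := mem_nth 0 (s := s); rewrite size_sorted_angles => /(_ j jM).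
by rewrite mem_sort.
Qed.

Definition wedge_start (j : 'I_M) : R := nth 0 s j.

Definition wedge_end (j : 'I_M) : R :=
  if (j.+1 < M)%N then nth 0 s j.+1 else nth 0 s 0 + P.

Lemma nth_sorted_bounds i : (i < M)%N -> 0 <= nth 0 s i < P.
Proof. by move=> /nth_sorted_angles/codomP[k ->]; exact: phiP. Qed.

Lemma nth_sorted_homo i k : (i <= k)%N -> (k < M)%N -> nth 0 s i <= nth 0 s k.
Proof.
move=> ik kM; apply: (sorted_leq_nth le_trans le_refl) => //.
- by case: sorted_anglesP.
- by rewrite inE size_sorted_angles (leq_ltn_trans ik).
- by rewrite inE size_sorted_angles.
Qed.

Let ord_gt0 (j : 'I_M) : (0 < M)%N.
Proof. exact: leq_ltn_trans (ltn_ord j). Qed.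

Lemma wedge_bounds (j : 'I_M) :
  [/\ 0 <= wedge_start j, wedge_start j <= wedge_end j,
      wedge_end j <= wedge_start j + P & wedge_end j <= P + P].
Proof.
have /andP[a0 aP] := nth_sorted_bounds (ltn_ord j).
rewrite /wedge_start /wedge_end; case: ifPn => jM.
  have /andP[b0 bP] := nth_sorted_bounds jM.
  by have := nth_sorted_homo (leqnSn j) jM; split; lra.
have /andP[b0 bP] := nth_sorted_bounds (ord_gt0 j).
by have := nth_sorted_homo (leq0n j) (ltn_ord j); split; lra.
Qed.

Lemma in_lift_wedge (j : 'I_M) z : z != x ->
  in_lift x (wedge_start j) (wedge_end j) z = if (j.+1 < M)%N
    then (nth 0 s j <= polar_angle x z) && ~~ (nth 0 s j.+1 <= polar_angle x z)
    else (nth 0 s j <= polar_angle x z) || ~~ (nth 0 s 0 <= polar_angle x z).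
Proof.
move=> /polar_angleP[/andP[z0 zP] _ _]; have pi0 := pi_gt0 R.
have /andP[a0 aP] := nth_sorted_bounds (ltn_ord j).
rewrite /in_lift /wedge_start /wedge_end; case: ifPn => jM; rewrite -!ltNge.
  have /andP[b0 bP] := nth_sorted_bounds jM.
  by apply/idP/idP; lra.
have /andP[b0 bP] := nth_sorted_bounds (ord_gt0 j).
have := nth_sorted_homo (leq0n j) (ltn_ord j).
by move=> ?; apply/idP/idP; lra.
Qed.

Lemma wedge_ind_lift (j : 'I_M) z :
  wedge_ind phi x j z = ((z != x) && in_lift x (wedge_start j) (wedge_end j) z)%:R.
Proof.
have [a0 ab baP bP] := wedge_bounds j.
by rewrite -lift_countB// -indic_angle_sector.
Qed.

Lemma wedge_indE (j : 'I_M) z : wedge_ind phi x j z =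
  lift_count x (wedge_end j) z - lift_count x (wedge_start j) z.
Proof.
have [a0 ab baP bP] := wedge_bounds j.
by rewrite -indic_angle_sector.
Qed.

(** Membership in a wedge depends only on which angles of [phi] are at most the polar angle. If both
    points use the same lift, these comparisons agree. Otherwise the interval crosses [P], all
    angles of [phi] lie between the two polar angles, and both points are in the last wedge. *)
Lemma wedge_ind_no_break u v z1 z2 : 0 <= u -> v <= P + P ->
  (forall t, t \in unrolled_breaks P (codom phi) -> u < t -> v <= t) ->
  z1 != x -> z2 != x -> in_lift x u v z1 -> in_lift x u v z2 ->
  forall j, wedge_ind phi x j z1 = wedge_ind phi x j z2.
Proof.
move=> u0 v2 uvB z1x z2x l1 l2 j; rewrite !wedge_ind_lift z1x z2x /=.
congr (nat_of_bool _)%:R; rewrite !in_lift_wedge//.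
have [/andP[a10 a1P] _ _] := polar_angleP z1x.
have [/andP[a20 a2P] _ _] := polar_angleP z2x.
set a1 := polar_angle x z1 in a10 a1P *.
set a2 := polar_angle x z2 in a20 a2P *.
have out t : t \in codom phi ->
    (t <= u \/ v <= t) /\ (t + P <= u \/ v <= t + P).
  move=> tphi; split.
    have [|ut] := leP t u; [by left|right; apply: uvB => //].
    by rewrite mem_cat tphi.
  have [|ut] := leP (t + P) u; [by left|right; apply: uvB => //].
  by rewrite mem_cat; apply/orP; right; apply/mapP; exists t.
have [cmp|cross|cross] : [\/ forall t, t \in codom phi -> (t <= a1) = (t <= a2),
    forall t, t \in codom phi -> (t <= a1) /\ ((t <= a2) = false) |
    forall t, t \in codom phi -> (t <= a2) /\ ((t <= a1) = false)].
- case/orP: l1 => /andP[l1 l1']; case/orP: l2 => /andP[l2 l2'].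
  + by apply: Or31 => t /out[[tu|vt] _]; apply/idP/idP;
      rewrite -/a1 -/a2 in l1 l1' l2 l2' *; lra.
  + apply: Or32 => t tphi; have /andP[t0 tP] : 0 <= t < P.
      by case/codomP: tphi => i ->; exact: phiP.
    by case: (out _ tphi) => -[tu|vt] [tu'|vt']; split;
      rewrite -/a1 -/a2 in l1 l1' l2 l2' *; try lra; apply/negP; lra.
  + apply: Or33 => t tphi; have /andP[t0 tP] : 0 <= t < P.
      by case/codomP: tphi => i ->; exact: phiP.
    by case: (out _ tphi) => -[tu|vt] [tu'|vt']; split;
      rewrite -/a1 -/a2 in l1 l1' l2 l2' *; try lra; apply/negP; lra.
  + by apply: Or31 => t /out[_ [tu|vt]]; apply/idP/idP;
      rewrite -/a1 -/a2 in l1 l1' l2 l2' *; lra.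
- have js := cmp _ (nth_sorted_angles (ltn_ord j)).
  case: ifP => jM; first by rewrite js (cmp _ (nth_sorted_angles jM)).
  by rewrite js (cmp _ (nth_sorted_angles (ord_gt0 j))).
- have [-> ->] := cross _ (nth_sorted_angles (ltn_ord j)).
  case: ifP => jM; first by have [-> ->] := cross _ (nth_sorted_angles jM).
  by have [-> ->] := cross _ (nth_sorted_angles (ord_gt0 j)).
- have [-> ->] := cross _ (nth_sorted_angles (ltn_ord j)).
  case: ifP => jM; first by have [-> ->] := cross _ (nth_sorted_angles jM).
  by have [-> ->] := cross _ (nth_sorted_angles (ord_gt0 j)).
Qed.

End Wedges.

(** * Integrals over the patch *)

Section NonmeasurableIntegral.
Local Open Scope ereal_scope.
Context d (T : measurableType d) (R : realType).
Variable mu : {measure set T -> \bar R}.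
Implicit Types (f g : T -> \bar R) (D : set T).

Lemma ae_implies (p q : T -> Prop) : (forall x, p x -> q x) ->
  {ae mu, forall x, p x} -> {ae mu, forall x, q x}.
Proof. by move=> pq; exact: filterS. Qed.

Import HBNNSimple.

(* A simple function below f is a.e. equal to its restriction off a measurable
   null set, which is below g. *)
Lemma ge0_ae_le_integral_nonmeasurable f g :
  (forall x, 0 <= f x) -> (forall x, 0 <= g x) ->
  {ae mu, forall x, f x <= g x} -> \int[mu]_x f x <= \int[mu]_x g x.
Proof.
move=> f0 g0 [N [mN N0 fgN]]; rewrite !ge0_integralTE//.
apply: ge_ereal_sup => _ [h hf <-]; apply: ereal_sup_ubound.
have mNC : measurable (~` N) by exact: measurableC.
exists (proj_nnsfun h mNC) => /=.
  move=> x; rewrite mindicE; have [xN|xN] := boolP (x \in ~` N).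
    rewrite mulr1 (le_trans (hf x))// leNgt; apply/negP => gf.
    by move: xN; rewrite inE; apply; apply: fgN => /=; rewrite leNgt gf.
  by rewrite mulr0.
have sE (k : {nnsfun T >-> R}) : sintegral mu k = \int[mu]_x (k x)%:E.
  by rewrite integral_nnsfun// patch_setT.
rewrite !sE.
apply: ae_eq_integral => //; try by apply/measurable_EFinP.
exists N; split=> // x /= H; apply: contrapT => xN; apply: H => _.
rewrite mindicE mem_set ?mulr1 //=.
Qed.

Lemma ae_eq_integral_nonmeasurable D f g :
  {ae mu, forall x, D x -> f x = g x} ->
  \int[mu]_(x in D) f x = \int[mu]_(x in D) g x.
Proof.
move=> fg; rewrite integralE [RHS]integralE.
have pm (k : (T -> \bar R) -> T -> \bar R) : (forall h x, 0 <= k h x) ->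
    (forall x, D x -> f x = g x -> k f x = k g x) ->
    \int[mu]_(x in D) k f x = \int[mu]_(x in D) k g x.
  move=> k0 kfg; rewrite integral_mkcond [RHS]integral_mkcond.
  have kD h x : 0 <= (k h \_ D) x by rewrite patchE; case: ifP.
  have ae : {ae mu, forall x, (k f \_ D) x = (k g \_ D) x}.
    apply: filterS fg => x fgx; rewrite !patchE; case: ifPn => // xD.
    by move: xD; rewrite inE => Dx; apply: kfg => //; exact: fgx.
  by apply/eqP; rewrite eq_le; apply/andP; split;
    apply: ge0_ae_le_integral_nonmeasurable => //;
    apply: filterS ae => x ->.
congr (_ - _); apply: pm => //.
by move=> x _ E; rewrite funepos.unlock E.
by move=> x _ E; rewrite funeneg.unlock E.
Qed.

End NonmeasurableIntegral.

Lemma ae_eq_Rintegral_nonmeasurable d (T : measurableType d) (R : realType)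
    (mu : {measure set T -> \bar R}) (D : set T) (f g : T -> R) :
  {ae mu, forall x, D x -> f x = g x} ->
  \int[mu]_(x in D) f x = \int[mu]_(x in D) g x.
Proof.
move=> fg; congr fine; apply: ae_eq_integral_nonmeasurable.
by apply: filterS fg => x fgx /fgx ->.
Qed.

Section SquarePatch.
Variables (R : realType) (center : R * R) (tau side : R).
Local Notation Omega := (square_patch center tau side).

Lemma measurable_square_patch :
  measurable (Omega : set (measurableTypeR R * measurableTypeR R)).
Proof.
pose T : measurableType _ := (measurableTypeR R * measurableTypeR R)%type.
have mX : measurable_fun [set: T] (fun z : T => z.1 - center.1 : R).
  by apply: measurable_funB => //; exact: measurable_fst.
have mY : measurable_fun [set: T] (fun z : T => z.2 - center.2 : R).
  by apply: measurable_funB => //; exact: measurable_snd.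
have mB : measurable_fun [set: T] (fun z : T =>
    (`|cos tau * (z.1 - center.1) + sin tau * (z.2 - center.2)| <= side / 2) &&
    (`|cos tau * (z.2 - center.2) - sin tau * (z.1 - center.1)| <= side / 2)).
  apply: measurable_and; apply: measurable_fun_ler => //;
    apply: (@measurableT_comp _ _ _ _ _ _ (@Num.norm R R)) => //;
    [apply: measurable_funD | apply: measurable_funB]; exact: measurable_funM.
have := mB measurableT [set true] I; rewrite setTI; congr measurable.
by apply/seteqP; split=> z; [move=> /andP[? ?] | move=> [? ?]; apply/andP].
Qed.

(** Rotating back bounds each coordinate offset by [side], so an axis-parallel square of side
    [2 * side] contains the patch. *)
Lemma square_patch_finite : (lebesgue2 R Omega < +oo)%E.
Proof.
pose A (c : R) : set (measurableTypeR R) := `[c - side, c + side]%classic.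
have mA c : measurable (A c) by exact: measurable_itv.
have sub : Omega `<=` A center.1 `*` A center.2.
  move=> z [/= H1 H2]; have := cos2Dsin2 tau.
  have := cos_le1 tau; have := cos_geN1 tau.
  have := sin_le1 tau; have := sin_geN1 tau.
  set c := cos tau in H1 H2 *; set s := sin tau in H1 H2 *.
  set X := z.1 - _ in H1 H2 *; set Y := z.2 - _ in H1 H2 *.
  move=> s1 s2 c1 c2 cs.
  have X' : X = c * (c * X + s * Y) - s * (c * Y - s * X).
    by rewrite -[LHS]mul1r -cs; ring.
  have Y' : Y = s * (c * X + s * Y) + c * (c * Y - s * X).
    by rewrite -[LHS]mul1r -cs; ring.
  have small k w : -1 <= k -> k <= 1 -> `|w| <= side / 2 -> `|k * w| <= side / 2.
    move=> k1 k2 wS; rewrite normrM -[leRHS]mul1r ler_pM//.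
    by rewrite ler_norml k1.
  have := small c _ c1 c2 H1; have := small s _ s1 s2 H2.
  have := small s _ s1 s2 H1; have := small c _ c1 c2 H2.
  rewrite !ler_norml => /andP[? ?] /andP[? ?] /andP[? ?] /andP[? ?].
  have HX : - side <= X <= side by apply/andP; split; lra.
  have HY : - side <= Y <= side by apply/andP; split; lra.
  rewrite /X in HX; rewrite /Y in HY.
  by rewrite /A; split=> /=; rewrite in_itv/=; apply/andP; split; lra.
apply: (@le_lt_trans _ _ (lebesgue2 R (A center.1 `*` A center.2))).
  apply: le_measure => //; rewrite inE; first exact: measurable_square_patch.
  exact: measurableX.
have -> : lebesgue2 R (A center.1 `*` A center.2) =
    (lebesgue_measure (A center.1) * lebesgue_measure (A center.2))%E.
  exact: product_measure1E.
rewrite !lebesgue_measure_itv /= !lte_fin.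
by case: ifP => _; case: ifP => _; rewrite ?mule0 ?mul0e// -EFinD -?EFinM ltry.
Qed.

End SquarePatch.

(** * Bounded measurable functions and their cumulative integrals *)

Section BoundedMeasurable.
Variables (R : realType) (Omega : set (R * R)).
Hypothesis mOmega :
  measurable (Omega : set (measurableTypeR R * measurableTypeR R)).
Hypothesis finOmega : (lebesgue2 R Omega < +oo)%E.
Implicit Types f g : R * R -> R.

Definition bounded_measurable f :=
  measurable_fun [set: measurableTypeR R * measurableTypeR R] f /\
  exists C, forall z, `|f z| <= C.

Lemma bounded_measurable_cst c : bounded_measurable (fun=> c).
Proof. by split; [exact: measurable_cst|exists `|c|]. Qed.

Lemma bounded_measurableD f g : bounded_measurable f -> bounded_measurable g ->
  bounded_measurable (fun z => f z + g z).
Proof.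
move=> [mf [C fC]] [mg [D gD]]; split; first exact: measurable_funD.
by exists (C + D) => z; rewrite (le_trans (ler_normD _ _))// lerD.
Qed.

Lemma bounded_measurableM f g : bounded_measurable f -> bounded_measurable g ->
  bounded_measurable (fun z => f z * g z).
Proof.
move=> [mf [C fC]] [mg [D gD]]; split; first exact: measurable_funM.
by exists (C * D) => z; rewrite normrM ler_pM.
Qed.

Lemma bounded_measurableB f g : bounded_measurable f -> bounded_measurable g ->
  bounded_measurable (fun z => f z - g z).
Proof.
move=> [mf [C fC]] [mg [D gD]]; split; first exact: measurable_funB.
by exists (C + D) => z; rewrite (le_trans (ler_normB _ _))// lerD.
Qed.

Lemma bounded_measurable_sum n (f : 'I_n -> R * R -> R) :
  (forall i, bounded_measurable (f i)) ->
  bounded_measurable (fun z => \sum_i f i z).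
Proof.
elim: n f => [|n IHn] f bf.
  rewrite (_ : (fun _ => _) = fun=> 0); first exact: bounded_measurable_cst.
  by apply/funext => z; rewrite big_ord0.
rewrite (_ : (fun _ => _) =
    fun z => \sum_(i < n) f (widen_ord (leqnSn n) i) z + f ord_max z).
  by apply: bounded_measurableD; [exact: IHn|].
by apply/funext => z; rewrite big_ord_recr.
Qed.

Lemma bounded_measurable_lift_count x t : bounded_measurable (lift_count x t).
Proof.
split; first exact: measurable_lift_count.
by exists 2 => z; rewrite ger0_norm ?lift_count_ge0// lift_count_le2.
Qed.

Lemma bounded_measurable_integrable f : bounded_measurable f ->
  (lebesgue2 R).-integrable Omega (EFin \o f).
Proof.
move=> [mf [C fC]]; apply: measurable_bounded_integrable => //.
  exact: measurable_funTS.
exists C; split; first exact: num_real.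
by move=> D CD z _ /=; exact: le_trans (fC z) (ltW CD).
Qed.

Definition patch_int f : R := \int[lebesgue2 R]_(z in Omega) f z.

Lemma patch_intD f g : bounded_measurable f -> bounded_measurable g ->
  patch_int (fun z => f z + g z) = patch_int f + patch_int g.
Proof.
by move=> bf bg; apply: RintegralD => //;
  exact: bounded_measurable_integrable.
Qed.

Lemma patch_intB f g : bounded_measurable f -> bounded_measurable g ->
  patch_int (fun z => f z - g z) = patch_int f - patch_int g.
Proof.
by move=> bf bg; apply: RintegralB => //;
  exact: bounded_measurable_integrable.
Qed.

Lemma patch_intZ c f : bounded_measurable f ->
  patch_int (fun z => c * f z) = c * patch_int f.
Proof. by move=> bf; apply: RintegralZl => //; exact: bounded_measurable_integrable. Qed.

Lemma patch_int_le f g : bounded_measurable f -> bounded_measurable g ->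
  (forall z, f z <= g z) -> patch_int f <= patch_int g.
Proof.
by move=> bf bg fg; apply: le_Rintegral => //; exact: bounded_measurable_integrable.
Qed.

Lemma patch_int_sum n (f : 'I_n -> R * R -> R) :
  (forall i, bounded_measurable (f i)) ->
  patch_int (fun z => \sum_i f i z) = \sum_i patch_int (f i).
Proof.
elim: n f => [|n IHn] f bf.
  rewrite big_ord0 -[RHS](mul0r (patch_int (fun=> 0))) -patch_intZ.
    by congr patch_int; apply/funext => z; rewrite big_ord0 mul0r.
  exact: bounded_measurable_cst.
rewrite big_ord_recr /= -IHn// -patch_intD//; last exact: bounded_measurable_sum.
by congr patch_int; apply/funext => z; rewrite big_ord_recr.
Qed.

Section Cumulative.
Variable x : R * R.
Local Notation P := (2 * @pi R).

(* Integral of g over the sector of angles in [0, t), continued from [0, 2 pi]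
   to [0, 4 pi] by periodicity of g. *)
Definition cumul g t : R := patch_int (fun z => lift_count x t z * g z).

Lemma cumulB g u v : bounded_measurable g -> cumul g v - cumul g u =
  patch_int (fun z => (lift_count x v z - lift_count x u z) * g z).
Proof.
move=> bg; rewrite /cumul -patch_intB; last 2 first.
- by apply: bounded_measurableM => //; exact: bounded_measurable_lift_count.
- by apply: bounded_measurableM => //; exact: bounded_measurable_lift_count.
by congr patch_int; apply/funext => z; rewrite mulrBl.
Qed.

Lemma cumulD g t : bounded_measurable g -> 0 <= t -> t <= P ->
  cumul g (t + P) = cumul g t + cumul g P.
Proof.
move=> bg t0 tP; rewrite /cumul -patch_intD; last 2 first.
- by apply: bounded_measurableM => //; exact: bounded_measurable_lift_count.
- by apply: bounded_measurableM => //; exact: bounded_measurable_lift_count.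
by congr patch_int; apply/funext => z; rewrite lift_countD// mulrDl.
Qed.

End Cumulative.
End BoundedMeasurable.

(** * The loss of a junction as a cyclic loss *)

Section JunctionLoss.
Variables (R : realType) (M K : nat) (alpha : R) (Omega : set (R * R)).
Hypothesis mOmega :
  measurable (Omega : set (measurableTypeR R * measurableTypeR R)).
Hypothesis finOmega : (lebesgue2 R Omega < +oo)%E.
Variables (I : R * R -> 'rV[R]_K) (x : R * R).
Variables (phis : 'I_M -> R) (cs : 'I_M -> 'rV[R]_K).
Hypothesis phisP : angle_box R M phis.
Hypothesis IE : noiseless_junction_image Omega I x phis cs.
Local Notation P := (2 * @pi R).
Local Notation bm := (@bounded_measurable R).

(** A measurable stand-in for the image [I], which agrees with it only almost everywhere on the
    patch. *)
Definition junction_color (k : 'I_K) (z : R * R) : R :=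
  \sum_(j < M) wedge_ind phis x j z * cs j ord0 k.

Local Notation F := (cumul Omega x (fun=> 1)).
Local Notation S := (fun k => cumul Omega x (junction_color k)).
Local Notation Q := (cumul Omega x (fun z => \sum_k junction_color k z ^+ 2)).

Lemma bounded_measurable_wedge_ind phi j : angle_box R M phi ->
  bm (wedge_ind phi x j).
Proof.
move=> phiP; rewrite (_ : wedge_ind _ _ _ = fun z =>
    lift_count x (wedge_end phi j) z - lift_count x (wedge_start phi j) z).
  by apply: bounded_measurableB; exact: bounded_measurable_lift_count.
by apply/funext => z; exact: wedge_indE.
Qed.

Lemma bounded_measurable_color k : bm (junction_color k).
Proof.
apply: bounded_measurable_sum => j; apply: bounded_measurableM.
  exact: bounded_measurable_wedge_ind.
exact: bounded_measurable_cst.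
Qed.

Lemma bounded_measurable_sqr_color : bm (fun z => \sum_k junction_color k z ^+ 2).
Proof.
apply: bounded_measurable_sum => k.
by apply: bounded_measurableM; exact: bounded_measurable_color.
Qed.

Let bm1 : bm (fun=> 1). Proof. exact: bounded_measurable_cst. Qed.

Lemma cumul_homo u v : u <= v -> F u <= F v.
Proof.
move=> uv; apply: patch_int_le => //.
- by apply: bounded_measurableM => //; exact: bounded_measurable_lift_count.
- by apply: bounded_measurableM => //; exact: bounded_measurable_lift_count.
- by move=> z; rewrite !mulr1 lift_count_homo.
Qed.

Lemma cumul_affine : affine_between_breaks P F Q S (codom phis).
Proof.
move=> u v u0 uv v2 uvB.
have [c cP] : exists c : 'I_K -> R, forall z, z != x -> in_lift x u v z ->
    forall k, junction_color k z = c k.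
  have [[z0 [z0x z0l]]|no] := pselect (exists z, z != x /\ in_lift x u v z).
    exists (fun k => junction_color k z0) => z zx zl k; apply: eq_bigr => j _.
    by rewrite (wedge_ind_no_break phisP u0 v2 uvB zx z0x zl z0l).
  by exists (fun=> 0) => z zx zl; case: no; exists z.
(* A point with no lift in [[u, v)] is counted equally at [u] and at [w], so only points where [g]
   equals [d] contribute; at the vertex all counts vanish. *)
have inc w z g d : u <= w -> w <= v -> (z != x -> in_lift x u v z -> g z = d) ->
    (lift_count x w z - lift_count x u z) * g z =
    d * ((lift_count x w z - lift_count x u z) * 1) :> R.
  move=> uw wv gd; have [zx|/negPn/eqP ->] := boolP (z != x); last first.
    by rewrite /lift_count /angle_below eqxx /= subrr !mul0r mulr0.
  have [zl|zl] := boolP (in_lift x u v z); first by rewrite gd//; ring.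
  suff -> : lift_count x w z - lift_count x u z = 0 by rewrite !mul0r mulr0.
  have le1 := lift_count_homo x z uw; have le2 := lift_count_homo x z wv.
  suff : lift_count x v z - lift_count x u z = 0 by lra.
  have sep a : ~~ (u <= a < v) -> (a < v) = (a < u).
    rewrite negb_and -ltNge -leNgt => /orP[au|va].
      by rewrite au (lt_le_trans au).
    by rewrite !ltNge va (le_trans uv).
  move: zl; rewrite negb_or => /andP[/sep E1 /sep E2].
  by rewrite /lift_count /angle_below zx /= !ltrBrDr E1 E2 subrr.
exists c => w uw wv; split=> [k|].
  rewrite !cumulB// -?patch_intZ//.
  - congr patch_int; apply/funext => z.
    by apply: (inc w z (junction_color k)) => // zx zl; exact: cP.
  - apply: bounded_measurableM => //.
    by apply: bounded_measurableB; exact: bounded_measurable_lift_count.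
  - exact: bounded_measurable_color.
rewrite !cumulB// -?patch_intZ//.
- congr patch_int; apply/funext => z.
  apply: (inc w z (fun z => \sum_k junction_color k z ^+ 2)) => // zx zl.
  by apply: eq_bigr => k _; rewrite cP.
- apply: bounded_measurableM => //.
  by apply: bounded_measurableB; exact: bounded_measurable_lift_count.
- exact: bounded_measurable_sqr_color.
Qed.

Lemma image_ae : {ae lebesgue2 R, forall z, Omega z ->
  forall k, I z ord0 k = junction_color k z}.
Proof.
apply: ae_implies IE => z Iz /Iz -> k; rewrite summxE; apply: eq_bigr => j _.
by rewrite mxE.
Qed.

Section Wedge.
Variables (phi : 'I_M -> R) (j : 'I_M).
Hypothesis phiP : angle_box R M phi.
Local Notation w := (wedge_ind phi x j).
Local Notation u := (wedge_start phi j).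
Local Notation v := (wedge_end phi j).
Local Notation int := (patch_int Omega).

Lemma wedge_int g : bm g ->
  int (fun z => w z * g z) = cumul Omega x g v - cumul Omega x g u.
Proof.
move=> bg; rewrite cumulB//; congr patch_int; apply/funext => z.
by rewrite wedge_indE.
Qed.

Lemma wedge_colorE k :
  wedge_color Omega I phi x j ord0 k = (S k v - S k u) / (F v - F u).
Proof.
rewrite mxE; congr (_ / _).
  rewrite -wedge_int; last exact: bounded_measurable_color.
  apply: ae_eq_Rintegral_nonmeasurable.
  by apply: ae_implies image_ae => z Iz /Iz ->.
rewrite -wedge_int//; congr patch_int; apply/funext => z; exact/esym/mulr1.
Qed.

(** Expanding the square makes the integrand a combination of the three cumulative integrands, with
    the wedge color as a constant. *)
Lemma wedge_loss :
  \int[lebesgue2 R]_(z in Omega)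
    (w z * sqnorm2 (wedge_color Omega I phi x j - I z)) = arc_loss F Q S u v.
Proof.
set c := wedge_color Omega I phi x j.
have bw := bounded_measurable_wedge_ind j phiP.
have bc k : bm (fun z => w z * junction_color k z).
  by apply: bounded_measurableM => //; exact: bounded_measurable_color.
have bw1 : bm (fun z => w z * 1) by exact: bounded_measurableM.
have bt k : bm (fun z => c ord0 k ^+ 2 * (w z * 1)
    - (c ord0 k *+ 2) * (w z * junction_color k z)).
  by apply: bounded_measurableB; apply: bounded_measurableM => //;
    exact: bounded_measurable_cst.
transitivity (int (fun z => w z * (\sum_k junction_color k z ^+ 2)
    + \sum_k (c ord0 k ^+ 2 * (w z * 1)
               - (c ord0 k *+ 2) * (w z * junction_color k z)))).
  apply: ae_eq_Rintegral_nonmeasurable.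
  apply: ae_implies image_ae => z Iz /Iz {}Iz.
  rewrite /sqnorm2 !mulr_sumr -big_split /=; apply: eq_bigr => k _.
  by rewrite !mxE -/c Iz; ring.
rewrite patch_intD//; last 2 first.
- by apply: bounded_measurableM => //; exact: bounded_measurable_sqr_color.
- exact: bounded_measurable_sum.
rewrite wedge_int; last exact: bounded_measurable_sqr_color.
rewrite patch_int_sum// /arc_loss; congr (_ + _); rewrite -sumrN.
apply: eq_bigr => k _; rewrite (patch_intB mOmega finOmega); last 2 first.
- by apply: bounded_measurableM => //; exact: bounded_measurable_cst.
- by apply: bounded_measurableM => //; exact: bounded_measurable_cst.
rewrite !patch_intZ// !wedge_int//; last exact: bounded_measurable_color.
rewrite wedge_colorE.
(* For a null wedge the color and the quotients in [arc_loss] are both 0 by the convention for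
   division, so both sides agree. *)
have [->|m0] := eqVneq (F v - F u) 0; last by field.
by rewrite invr0; ring.
Qed.

End Wedge.

Lemma junction_nllE phi : angle_box R M phi ->
  junction_nll alpha Omega I phi x =
  alpha * cyclic_loss P F Q S (sort <=%R (codom phi)).
Proof.
move=> phiP; rewrite cyclic_lossE size_sorted_angles; congr (_ * _).
by apply: eq_bigr => j _; rewrite wedge_loss.
Qed.

Lemma junction_nll_ge0 (phi : 'I_M -> R) : 0 < alpha ->
  0 <= junction_nll alpha Omega I phi x.
Proof.
move=> alpha0; rewrite mulr_ge0 ?(ltW alpha0)// sumr_ge0// => j _.
apply: Rintegral_ge0 => z _; rewrite mulr_ge0//.
by apply: sumr_ge0 => k _; rewrite sqr_ge0.
Qed.

End JunctionLoss.

(** The first conclusion makes every update of the algorithm well defined; the second holds for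
    every choice among minimizers. *)
Theorem theorem1 (R : realType) (M K : nat) (alpha : R)
    (center : R * R) (tau side : R) (I : R * R -> 'rV[R]_K) (x0 : R * R)
    (phis : 'I_M -> R) (cs : 'I_M -> 'rV[R]_K) :
  (1 <= M)%N -> (1 <= K)%N -> 0 < alpha -> 0 < side ->
  angle_box R M phis ->
  noiseless_junction_image (square_patch center tau side) I x0 phis cs ->
  let l := fun phi : 'I_M -> R =>
    junction_nll alpha (square_patch center tau side) I phi x0 in
  (forall (phi : 'I_M -> R) (j : 'I_M), angle_box R M phi ->
     exists a : R,
       argmin_on (angle_range R) (fun b => l (set_angle phi j b)) a) /\
  (forall t : nat -> 'I_M -> R, coordinate_pass l t ->
     argmin_on (angle_box R M) l (t M)).
Proof.
move=> M0 _ alpha0 _ phisP IE l.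
have mO := measurable_square_patch center tau side.
have fO := square_patch_finite center tau side.
have F_homo u v (_ : 0 <= u) uv (_ : v <= 2 * pi + 2 * pi) :=
  @cumul_homo _ _ mO fO x0 u v uv.
have aff := cumul_affine mO fO x0 cs phisP.
have lE := junction_nllE alpha mO fO phisP IE.
have l0 phi : 0 <= l phi by exact: junction_nll_ge0.
have FP := cumulD mO fO x0 (bounded_measurable_cst 1).
have SP k t := cumulD mO fO x0 (t := t) (bounded_measurable_color x0 cs phisP k).
have QP := cumulD mO fO x0 (bounded_measurable_sqr_color x0 cs phisP).
split=> [phi j phiP|t tP].
  exact: (angle_argmin_exists F_homo aff FP QP SP phisP alpha0 lE).
exact: (pass_argmin F_homo aff FP QP SP phisP alpha0 lE l0).
Qed.
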